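(* Let $\Lambda=\bigcup_{k=1}^{\infty}[a_k,b_k]\subset\mathbb{R}_+$ be a lacunary system of intervals and let $f\in L^2(\mathbb{R}_+)$ with $\operatorname{supp}(f)\subset\Lambda$. For $k\ge 1$ let $f_k\in L^2(0,b_k-a_k)\subset L^2(\mathbb{R}_+)$ be the function given by $f_k(x)=f(x+a_k)$ for $0\le x\le b_k-a_k$ and $f_k(x)=0$ for $x>b_k-a_k$, so that $f(x)=\sum_{k\ge 1}f_k(x-a_k)$, and assume $f_k\neq 0$ for every $k\ge 1$. Suppose that (i) $c=\sup_{k\ge 1}|b_k-a_k|<\infty$; (ii) the sequence $\big(f_k/\|f_k\|_2\big)_{k\ge 1}$ is relatively compact in $L^2(0,c)$. Then $f$ is cyclic in $L^2(\mathbb{R}_+)$, i.e. $E_f=L^2(\mathbb{R}_+)$.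
   Context: $\mathbb{R}_+=[0,\infty)$, and $L^2(\mathbb{R}_+)$ is the usual (complex) $L^2$ space with norm $\|\cdot\|_2$. For $0<a<\infty$, $L^2(0,a)$ is regarded as a subspace of $L^2(\mathbb{R}_+)$ by extending functions by $0$ on $(a,\infty)$. The semigroup of left translations $(S_t^* )_{t>0}$ on $L^2(\mathbb{R}_+)$ is $S_t^*f(x)=f(x+t)$, $x\ge 0$, $t>0$. For $f\in L^2(\mathbb{R}_+)$, $E_f$ denotes the closed linear span in $L^2(\mathbb{R}_+)$ of $\{S_t^*f: t>0\}$; $f$ is called cyclic if $E_f=L^2(\mathbb{R}_+)$. A lacunary system of intervals is a countable union $\Lambda=\bigcup_{k=1}^{\infty}[a_k,b_k]$ of intervals (here contained in $\mathbb{R}_+$) such that (1) $a_k<b_k<a_{k+1}$ for all $k\ge 1$, and (2) $\sup_{k\ge 1} b_k/a_{k+1}<1$. A sequence is relatively compact if the set of its terms has compact closure (in norm). *)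

(* Defs.v *)
From HB Require Import structures.
From mathcomp Require Import all_boot all_order all_algebra.
From mathcomp Require Import generic_quotient ring_quotient complex.
From mathcomp Require Import all_classical all_reals all_analysis.
From mathcomp Require Import measurable_realfun.

Set Implicit Arguments.
Unset Strict Implicit.
Unset Printing Implicit Defensive.

Import Order.TTheory GRing.Theory Num.Theory numFieldNormedType.Exports.
Import ComplexField.Normc.

Local Open Scope classical_set_scope.
Local Open Scope ring_scope.
Local Open Scope quotient_scope.

(* Lebesgue measure of `[0, +oo[, seen as a measure on the whole line that
   gives mass 0 to the negative numbers: the values of a function at negative
   points are irrelevant to everything that is stated almost everywhere for
   [muRp] or integrated against [muRp]. A function on `[0, +oo[ is represented
   by any of its measurable extensions, such as its extension by 0. *)
Definition muRp (R : realType) : {measure set (measurableTypeR R) -> \bar R} :=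
  mrestr (@lebesgue_measure R) (measurable_itv `[0%R, +oo[).

Definition linear_span (K : numFieldType) (V : lmodType K) (A : set V) : set V :=
  [set v | exists n (k : 'I_n -> K) (w : 'I_n -> V),
     (forall i, A (w i)) /\ v = \sum_(i < n) k i *: w i].

(* Closure and compactness are those of the subspace topology of [V]. *)
Definition relatively_compact_in (X : topologicalType) (V : set X)
    (u : nat -> X) : Prop :=
  compact (closure (range u) `&` V).

(* The intervals are indexed from 0, and [b k / a k.+1] is a genuine quotient as
   [0 <= a k < a k.+1]. *)
Definition lacunary (R : realType) (a b : nat -> R) : Prop :=
  [/\ forall k, `[a k, b k]%classic `<=` `[0, +oo[%classic,
      forall k, a k < b k < a k.+1 &
      (ereal_sup (range (fun k => (b k / a k.+1)%:E)) < 1)%E].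

Section square_integrable.
Context (R : realType).
Local Notation C := R[i].
Local Notation mu := (muRp R).
Implicit Types (f g : R -> C) (a : C).

Definition sq_integrable : {pred R -> C} := mem [set f : R -> C |
  [/\ measurable_fun setT (@complex.Re R \o f),
      measurable_fun setT (@complex.Im R \o f) &
      finite_norm mu 2%:E (@normc R \o f)]].

Lemma sq_integrableP f : f \in sq_integrable <->
  [/\ measurable_fun setT (@complex.Re R \o f),
      measurable_fun setT (@complex.Im R \o f) &
      finite_norm mu 2%:E (@normc R \o f)].
Proof. by split => [/set_mem|/mem_set]. Qed.

Lemma normc_ge0 (z : C) : 0 <= normc z.
Proof. by case: z => x y /=; exact: sqrtr_ge0. Qed.

Lemma measurable_normc f : measurable_fun setT (@complex.Re R \o f) ->
  measurable_fun setT (@complex.Im R \o f) ->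
  measurable_fun setT (@normc R \o f).
Proof.
move=> mr mi.
have -> : @normc R \o f =
    (fun x => Num.sqrt ((complex.Re (f x)) ^+ 2 + (complex.Im (f x)) ^+ 2)).
  by apply/funext => x /=; case: (f x).
apply: (measurableT_comp (continuous_measurable_fun (@sqrt_continuous R))).

by apply: measurable_funD; apply: measurable_funX.
Qed.

Lemma normc_Lfun f : f \in sq_integrable -> @normc R \o f \in Lfun mu 2%:E.
Proof.
move/sq_integrableP => [mr mi fin]; apply/andP; split; apply/mem_set => //=.
exact: measurable_normc.
Qed.

Lemma le_Lnorm2 (f g : R -> R) : measurable_fun setT f ->
  measurable_fun setT g -> (forall x, `|f x| <= `|g x|) ->
  ('N[mu]_2%:E[EFin \o f] <= 'N[mu]_2%:E[EFin \o g])%E.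
Proof.
move=> mf mg fg; rewrite unlock; apply: gt0_ler_poweR.
- by rewrite invr_ge0.
- by rewrite in_itv/= leey integral_ge0.
- by rewrite in_itv/= leey integral_ge0.
- apply: ge0_le_integral => //=.
  + by apply/measurable_EFinP; apply: (measurableT_comp (measurable_powR _));
       exact: measurableT_comp.
  + by apply/measurable_EFinP; apply: (measurableT_comp (measurable_powR _));
       exact: measurableT_comp.
  + by move=> x _; rewrite lee_fin ge0_ler_powR// nnegrE.
Qed.

Lemma LnormD_normc f g : f \in sq_integrable -> g \in sq_integrable ->
  ('N[mu]_2%:E[EFin \o (@normc R \o (f + g)%R)] <=
   'N[mu]_2%:E[EFin \o (@normc R \o f)] +
   'N[mu]_2%:E[EFin \o (@normc R \o g)])%E.
Proof.
move=> /sq_integrableP[mfr mfi _] /sq_integrableP[mgr mgi _].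
have mf := measurable_normc mfr mfi; have mg := measurable_normc mgr mgi.
apply: (@le_trans _ _
  'N[mu]_2%:E[EFin \o ((@normc R \o f) \+ (@normc R \o g))%R])%E.
  apply: le_Lnorm2.
  - apply: measurable_normc.
      rewrite (_ : _ \o _ = (@complex.Re R \o f) \+ (@complex.Re R \o g)).
        exact: measurable_funD.
      by apply/funext => x/=; rewrite fctE; case: (f x) (g x) => [? ?] [].
    rewrite (_ : _ \o _ = (@complex.Im R \o f) \+ (@complex.Im R \o g)).
      exact: measurable_funD.
    by apply/funext => x/=; rewrite fctE; case: (f x) (g x) => [? ?] [].
  - exact: measurable_funD.
  - move=> x /=; rewrite !ger0_norm ?addr_ge0 ?normc_ge0//.
    exact: le_normcD.
by apply: eminkowski => //; rewrite lee1n.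
Qed.

Lemma LnormZ_normc a f : f \in sq_integrable ->
  ('N[mu]_2%:E[EFin \o (@normc R \o (a *: f)%R)] =
   (normc a)%:E * 'N[mu]_2%:E[EFin \o (@normc R \o f)])%E.
Proof.
move=> /normc_Lfun lf.
have := @LnormZ _ _ _ mu 2%:E (lee1n 2) (Lfun_Sub _ lf) (normc a).
rewrite Lfun_valP ger0_norm ?normc_ge0// => <-.
by apply: eq_Lnorm => x /=; rewrite [in LHS]/GRing.scale/= normcM.
Qed.

Lemma sq_integrable_submod_closed : submod_closed sq_integrable.
Proof.
split.
  apply/sq_integrableP; split.
  - by rewrite (_ : _ \o _ = cst 0)//; apply/funext.
  - by rewrite (_ : _ \o _ = cst 0)//; apply/funext.
  - rewrite /finite_norm (_ : _ \o _ = cst 0%E) ?Lnorm0 ?ltry//.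
    by apply/funext => x; congr EFin; exact: normc0.
move=> a f g hf hg.
have haf : a *: f \in sq_integrable.
  move: (hf) => /sq_integrableP[mr mi fin]; apply/sq_integrableP; split.
  - rewrite (_ : _ \o _ = (cst (complex.Re a) \* (@complex.Re R \o f)) \-
                          (cst (complex.Im a) \* (@complex.Im R \o f))).
      by apply: measurable_funB; apply: measurable_funM.
    apply/funext => x/=.
    by rewrite -[(a *: f) x]/(a * f x); case: a (f x) => [? ?] [].
  - rewrite (_ : _ \o _ = (cst (complex.Re a) \* (@complex.Im R \o f)) \+
                          (cst (complex.Im a) \* (@complex.Re R \o f))).
      by apply: measurable_funD; apply: measurable_funM.
    apply/funext => x/=.
    by rewrite -[(a *: f) x]/(a * f x); case: a (f x) => [? ?] [].
  - by rewrite /finite_norm LnormZ_normc// lte_mul_pinfty// lee_fin normc_ge0.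
move: (haf) (hg) => /sq_integrableP[mr mi fin] /sq_integrableP[mr' mi' fin'].
apply/sq_integrableP; split.
- rewrite (_ : _ \o _ = (@complex.Re R \o (a *: f)) \+ (@complex.Re R \o g)).
    exact: measurable_funD.
  by apply/funext => x/=; rewrite fctE; case: ((a *: f) x) (g x) => [? ?] [].
- rewrite (_ : _ \o _ = (@complex.Im R \o (a *: f)) \+ (@complex.Im R \o g)).
    exact: measurable_funD.
  by apply/funext => x/=; rewrite fctE; case: ((a *: f) x) (g x) => [? ?] [].
- rewrite /finite_norm; apply: (le_lt_trans (LnormD_normc haf hg)).
  exact: lte_add_pinfty.
Qed.

HB.instance Definition _ := GRing.isSubmodClosed.Build C (R -> C)
  sq_integrable sq_integrable_submod_closed.

End square_integrable.

Record sqfun (R : realType) := SqFun {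
  sqfun_val :> R -> R[i]; _ : sqfun_val \in @sq_integrable R }.

Section sqfun.
Context (R : realType).
Local Notation C := R[i].
Local Notation mu := (muRp R).

HB.instance Definition _ := [isSub of sqfun R for @sqfun_val R].
HB.instance Definition _ := [Choice of sqfun R by <:].
HB.instance Definition _ := [SubChoice_isSubLmodule of sqfun R by <:].

Definition sqnorm (f : sqfun R) : R :=
  fine 'N[mu]_2%:E[EFin \o (@normc R \o f)]%E.

Definition ae_null : {pred sqfun R} :=
  mem [set f : sqfun R | {ae mu, forall x, f x = 0}].

Lemma ae_nullP (f : sqfun R) :
  f \in ae_null <-> {ae mu, forall x, f x = 0}.
Proof. by split => [/set_mem|/mem_set]. Qed.

Lemma ae_null_submod_closed : submod_closed ae_null.
Proof.
split; first by apply/ae_nullP/aeW => x.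
move=> a f g /ae_nullP f0 /ae_nullP g0; apply/ae_nullP.
apply: (@filterS2 _ _ (ae_filter_ringOfSetsType mu) _ _ _ _ f0 g0) => x fx gx.
by rewrite -[LHS]/(a * f x + g x) fx gx mulr0 addr0.
Qed.

HB.instance Definition _ := GRing.isSubmodClosed.Build C (sqfun R)
  ae_null ae_null_submod_closed.


Lemma sqnormE (f : sqfun R) :
  ((sqnorm f)%:E = 'N[mu]_2%:E[EFin \o (@normc R \o f)])%E.
Proof.
rewrite /sqnorm fineK// ge0_fin_numE ?Lnorm_ge0//.
by have /sq_integrableP[] := valP f.
Qed.

Lemma sqnorm_ge0 (f : sqfun R) : 0 <= sqnorm f.
Proof. by rewrite /sqnorm fine_ge0// Lnorm_ge0. Qed.

Lemma sqnormD (f g : sqfun R) : sqnorm (f + g) <= sqnorm f + sqnorm g.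
Proof. by rewrite -lee_fin EFinD !sqnormE; apply: LnormD_normc; exact: valP. Qed.

Lemma sqnormZ a (f : sqfun R) : sqnorm (a *: f) = normc a * sqnorm f.
Proof.
by apply/EFin_inj; rewrite EFinM !sqnormE; apply: LnormZ_normc; exact: valP.
Qed.

Lemma sqnorm_eq0 (f : sqfun R) : (sqnorm f == 0) = (f \in ae_null).
Proof.
have /sq_integrableP[mr mi fin] := valP f.
have mf := measurable_normc mr mi.
apply/eqP/idP => [|/ae_nullP f0].
  move=> f0; apply/ae_nullP.
  have : ('N[mu]_2%:E[EFin \o (@normc R \o f)])%E = 0%E by rewrite -sqnormE f0.
  move/Lnorm_eq0_eq0 => /(_ _ _)[]//.
    exact/measurable_EFinP.
  move=> A [mA A0 sub]; exists A; split => // x /= nfx; apply: sub => /= h.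
  by apply: nfx; have [] := h I => /eq0_normc.
rewrite /sqnorm unlock.
rewrite (ae_eq_integral (cst 0%E))//=.
- by rewrite integral0 poweR0r// invr_neq0.
- apply/measurable_EFinP; apply: (measurableT_comp (measurable_powR _)).
  exact: measurableT_comp.
- apply: (@filterS _ _ (ae_filter_ringOfSetsType mu) _ _ _ f0) => x fx _ /=.
  by rewrite -[sqfun_val f x]/(f x) fx normc0 normr0 powR0.
Qed.

End sqfun.

(* Square integrable functions on [0, +oo[ up to equality almost everywhere; the
   values of the norm are the real elements of the scalar field R[i]. *)
Definition L2 (R : realType) := Quotient.quot (@ae_null R).
HB.instance Definition _ (R : realType) := GRing.Zmodule.on (L2 R).

Section L2.
Context (R : realType).
Local Notation C := R[i].
Local Notation mu := (muRp R).
Implicit Types (f g : sqfun R) (u v : L2 R) (a b : C).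

Definition L2class f : L2 R := \pi_(Quotient.quot (@ae_null R)) f.
Definition L2repr u : sqfun R := repr u.

Lemma L2reprK u : L2class (L2repr u) = u.
Proof. exact: reprK. Qed.

Lemma L2class_eq f g : (L2class f == L2class g) = (f - g \in @ae_null R).
Proof. by rewrite Quotient.idealrBE. Qed.

Lemma L2classD f g : L2class (f + g) = L2class f + L2class g.
Proof. by rewrite /L2class !piE. Qed.

Definition L2scale a u : L2 R := L2class (a *: L2repr u).

Lemma L2classZ a f : L2class (a *: f) = L2scale a (L2class f).
Proof.
apply/eqP; rewrite L2class_eq -scalerBr rpredZ// -L2class_eq.
by rewrite L2reprK.
Qed.

Lemma L2scaleA a b u : L2scale a (L2scale b u) = L2scale (a * b) u.
Proof. by rewrite -[u]L2reprK -!L2classZ scalerA. Qed.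

Lemma L2scale1 : left_id 1 L2scale.
Proof. by move=> u; rewrite -[u]L2reprK -!L2classZ scale1r. Qed.

Lemma L2scaleDr : right_distributive L2scale +%R.
Proof.
move=> a u v; rewrite -[u]L2reprK -[v]L2reprK.
by rewrite -!L2classZ -!L2classD -!L2classZ scalerDr.
Qed.

Lemma L2scaleDl u : {morph L2scale^~ u : a b / a + b}.
Proof.
by move=> a b /=; rewrite -[u]L2reprK -!L2classZ -!L2classD scalerDl.
Qed.

HB.instance Definition _ := GRing.Zmodule_isLmodule.Build C (L2 R)
  L2scaleA L2scale1 L2scaleDr L2scaleDl.

Definition L2norm u : C := (sqnorm (L2repr u))%:C%C.

Lemma sqnorm_repr f : sqnorm (L2repr (L2class f)) = sqnorm f.
Proof.
suff H g h : L2class g = L2class h -> sqnorm g <= sqnorm h.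
  by apply/eqP; rewrite eq_le !H// L2reprK.
move=> /eqP; rewrite L2class_eq -sqnorm_eq0 => /eqP gh0.
by have := sqnormD (g - h) h; rewrite subrK gh0 add0r.
Qed.

Lemma L2normD u v : L2norm (u + v) <= L2norm u + L2norm v.
Proof.
rewrite /L2norm -[u in X in X <= _]L2reprK -[v in X in X <= _]L2reprK.
rewrite -L2classD sqnorm_repr -rmorphD/= lecR; exact: sqnormD.
Qed.

Lemma L2normZ a u : L2norm (a *: u) = `|a| * L2norm u.
Proof.
rewrite /L2norm sqnorm_repr sqnormZ rmorphM/=; congr (_ * _).
Qed.

Lemma L2norm_eq0 u : L2norm u = 0 -> u = 0.
Proof.
move=> [/eqP]; rewrite sqnorm_eq0 => u0; rewrite -[u]L2reprK.
have -> : 0 = L2class 0 by rewrite /L2class !piE.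
by apply/eqP; rewrite L2class_eq subr0.
Qed.

HB.instance Definition _ := Lmodule_isNormed.Build C (L2 R)
  L2normD L2normZ L2norm_eq0.

End L2.

Section L2_operators.
Context (R : realType).
Local Notation C := R[i].
Local Notation mu := (muRp R).
Local Notation shift t :=
  ((fun x => (x + t)%R) : measurableTypeR R -> measurableTypeR R).
Implicit Types (f g : sqfun R) (u v : L2 R) (t : R).

(* The class of a square integrable function; the value 0 is used for
   functions that are not square integrable; by [translate_sq] and [window_sq],
   this does not affect [Sstar] and [block] for nonnegative shifts. *)
Definition L2of (h : R -> C) : L2 R := L2class (insubd 0 h).

Lemma L2repr_class f : {ae mu, forall x, L2repr (L2class f) x = f x}.
Proof.
have /eqP := L2reprK (L2class f); rewrite L2class_eq => /ae_nullP.
apply: (@filterS _ _ (ae_filter_ringOfSetsType mu)) => x.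
by rewrite -[LHS]/(L2repr (L2class f) x - f x) => /subr0_eq.
Qed.

Lemma L2of_ae (h : R -> C) : h \in @sq_integrable R ->
  {ae mu, forall x, L2repr (L2of h) x = h x}.
Proof. by move=> hh; have := L2repr_class (insubd 0 h); rewrite insubdK. Qed.

Lemma lebesgue_measure_translate t (A : set R) : measurable A ->
  lebesgue_measure (shift t @^-1` A) = lebesgue_measure A.
Proof.
move=> mA.
have mt : measurable_fun setT (shift t) by exact: measurable_funD.
apply/esym/(@lebesgue_measure_unique R (pushforward lebesgue_measure
  (shift t))) => //= _ [[x y]] _ <-.
rewrite /pushforward/=.
have -> : (fun z : R => z + t) @^-1` `]x, y] = `]x - t, y - t]%classic.
  by apply/seteqP; split=> z /=; rewrite !in_itv/= ltrBlDr lerBrDr.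
rewrite !lebesgue_measure_itv/= !lte_fin ltrD2r -!EFinB.
by rewrite opprB addrA subrK.
Qed.

Lemma muRp_translate_le t (A : set R) : 0 <= t -> measurable A ->
  (mu (shift t @^-1` A) <= mu A)%E.
Proof.
move=> t0 mA; rewrite /muRp /= /mrestr.
rewrite -[leRHS](@lebesgue_measure_translate t); last exact: measurableI.
apply: le_measure; rewrite ?inE.
- apply: measurableI => //.
  by rewrite -[X in measurable X]setTI; apply: measurable_funD.
- rewrite -[X in measurable X]setTI; apply: measurable_funD => //.
  exact: measurableI.
- move=> x [Ax]; rewrite /= !in_itv/= !andbT => x0; split; first by [].
  exact: addr_ge0.
Qed.

Lemma ae_translate t (P : R -> Prop) : 0 <= t -> {ae mu, forall x, P x} ->
  {ae mu, forall x, P (x + t)}.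
Proof.
move=> t0 [A [mA A0 sub]]; exists (shift t @^-1` A); split.
- by rewrite -[X in measurable X]setTI; apply: measurable_funD.
- by apply/eqP; rewrite eq_le measure_ge0 andbT -A0; exact: muRp_translate_le.
- by move=> x /= nP; exact: sub.
Qed.

Lemma translate_sq t (h : R -> C) : 0 <= t -> h \in @sq_integrable R ->
  (fun x => h (x + t)) \in @sq_integrable R.
Proof.
move=> t0 /sq_integrableP[mr mi fin].
have mt : measurable_fun setT (shift t) by exact: measurable_funD.
have mN := measurable_normc mr mi.
apply/sq_integrableP; split.
- exact: (measurableT_comp mr mt).
- exact: (measurableT_comp mi mt).
- apply: le_lt_trans fin; rewrite unlock; apply: gt0_ler_poweR.
  + by rewrite invr_ge0.
  + by rewrite in_itv/= leey integral_ge0.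
  + by rewrite in_itv/= leey integral_ge0.
  pose F := fun x : measurableTypeR R => ((`|normc (h x)| `^ 2)%R)%:E.
  have mF : measurable_fun setT F.
    apply/measurable_EFinP; apply: (measurableT_comp (measurable_powR _)).
    exact: measurableT_comp.
  have F0 x : (0 <= F x)%E by rewrite lee_fin powR_ge0.
  have -> : (\int[mu]_x `|(EFin \o (@normc R \o (fun x0 => h (x0 + t)%R))) x| `^ 2)%E
     = (\int[pushforward mu (shift t)]_x F x)%E.
    by rewrite ge0_integral_pushforward.
  apply: ge0_le_measure_integral => //= B mB.
  exact: (muRp_translate_le t0 mB).
Qed.

Lemma window_sq (d : R) (h : R -> C) : h \in @sq_integrable R ->
  (fun x : R => if 0 <= x <= d then h x else 0) \in @sq_integrable R.
Proof.
move=> /sq_integrableP[mr mi fin].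
have mw (p : R -> R) : measurable_fun setT p ->
    measurable_fun setT (fun x : R => if 0 <= x <= d then p x else 0).
  move=> mp; apply: measurable_fun_ifT => //.
  by apply: measurable_and; exact: measurable_fun_ler.
have mr' : measurable_fun setT
    (@complex.Re R \o (fun x : R => if 0 <= x <= d then h x else 0)).
  rewrite (_ : _ \o _ =
    (fun x : R => if 0 <= x <= d then (@complex.Re R \o h) x else 0)); first exact: mw.
  by apply/funext => x /=; case: ifP.
have mi' : measurable_fun setT
    (@complex.Im R \o (fun x : R => if 0 <= x <= d then h x else 0)).
  rewrite (_ : _ \o _ =
    (fun x : R => if 0 <= x <= d then (@complex.Im R \o h) x else 0)); first exact: mw.
  by apply/funext => x /=; case: ifP.
apply/sq_integrableP; split => //.
apply: le_lt_trans fin; apply: le_Lnorm2; try exact: measurable_normc.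
move=> x /=; case: ifP => // _.
by rewrite [X in `|X|](@normc0 R) normr0.
Qed.

(* Left translation, meant for [0 <= t] *)
Definition Sstar t u : L2 R := L2of (fun x => L2repr u (x + t)).

Lemma Sstar_ae t f : 0 <= t ->
  {ae mu, forall x, L2repr (Sstar t (L2class f)) x = f (x + t)}.
Proof.
move=> t0.
have h1 := L2of_ae (translate_sq t0 (valP (L2repr (L2class f)))).
have h2 := ae_translate t0 (L2repr_class f).
apply: (@filterS2 _ _ (ae_filter_ringOfSetsType mu) _ _ _ _ h1 h2) => x e1 e2.
exact: etrans e1 e2.
Qed.

Definition block (a b : R) u : L2 R :=
  L2of (fun x => if 0 <= x <= b - a then L2repr u (x + a) else 0).

Lemma block_ae (a b : R) f : 0 <= a ->
  {ae mu, forall x, L2repr (block a b (L2class f)) x =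
    if 0 <= x <= b - a then f (x + a) else 0}.
Proof.
move=> a0.
have h1 := L2of_ae (window_sq (b - a)
  (translate_sq a0 (valP (L2repr (L2class f))))).
have h2 := ae_translate a0 (L2repr_class f).
apply: (@filterS2 _ _ (ae_filter_ringOfSetsType mu) _ _ _ _ h1 h2) => x e1 e2.
by apply: etrans e1 _; case: ifP => // _; exact: e2.
Qed.

(* The complement of the largest open set on which [u] vanishes a.e.;
   it contains no negative number because [muRp] does not charge them. *)
Definition L2supp u : set R :=
  ~` \bigcup_(U in [set U : set R | open U /\
        {ae mu, forall x, U x -> L2repr u x = 0}]) U.

Definition L2_on (c : R) : set (L2 R) :=
  [set u | {ae mu, forall x, c < x -> L2repr u x = 0}].

Definition cyclic_subspace u : set (L2 R) :=
  closure (linear_span [set Sstar t u | t in [set t : R | 0 < t]]).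

Definition is_cyclic u : Prop := cyclic_subspace u = [set: L2 R].

End L2_operators.

(* Main.v *)
Require Import Defs.
From mathcomp Require Import all_boot all_order all_algebra.
From mathcomp Require Import complex.
From mathcomp Require Import all_classical all_reals all_analysis.
From mathcomp Require Import measurable_realfun ring lra.

(** Write [f = \sum_k f_k (x - a_k)] and let [E] be the closed span of the left
    translates of [f]. Translating [f] by [a_k] and dividing by the norm of
    [f_k] gives the normalised piece [f_k / |f_k|] followed by a rest, the
    translate of everything after the [k]-th interval. A single rest need not
    be small, but averages of them are: by lacunarity, among the rests of large
    index at most [M] are nonzero at a given point, where [M] depends only on
    the system ([overlap_count]), so a convex combination with weights [w_k] has a rest of
    squared norm at most [M * \sum_k w_k ^ 2 / d_k], where [d_k] is the energy
    of [f_k] divided by the energy of what follows. For [w_k] proportional to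
    [d_k] this is [M / \sum_k d_k], and the series of the [d_k] diverges, since
    the energies of the rests tend to 0 ([defects_diverge]).

    For the average of the pieces to make sense the pieces should resemble each
    other. This is where compactness enters: the divergence of the series
    is already due to the [k] for which [f_k / |f_k|] is close to a certain
    [h], nonzero and vanishing outside of [0, c] ([compact_heavy_point]). Averaging
    over these [k] gives [h] in [E], and averaging the translates by [a_k + t]
    instead gives the translate of [h] by [t] in [E] for every real [t]
    ([translate_mem]), right translates included, because the gaps before the
    [a_k] become arbitrarily long.

    It remains to see that the translates of [h] are total
    ([translates_total]). A function nearly orthogonal to all of them has, after
    integration of its correlation with [h] against [exp (l t)], a small product
    of its Laplace transform with that of [h] ([correlation_laplace]).
    Consequently [E] contains the exponentials [exp (- l x)] for the [l] in an
    interval on which the transform of [h] does not vanish. These are dense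
    ([expo_dense]): by analyticity in the exponent one gets all positive [l];
    the double exponentials [1 - exp (- exp (N (a - x)))] are convergent series
    of exponentials and tend to the indicator of [x < a] as [N] grows;
    indicators lead to everything. The same density shows that the transform
    of [h] is not identically zero. *)

Import Order.TTheory GRing.Theory Num.Theory numFieldNormedType.Exports.
Import ComplexField.Normc.

Local Open Scope classical_set_scope.
Local Open Scope ring_scope.

(** * Square integrable functions and closed subspaces *)

Section square_norms.
Set Implicit Arguments.
Unset Strict Implicit.
Unset Printing Implicit Defensive.
Context {R : realType}.
Local Notation C := R[i].
Local Notation mu := (muRp R).
Local Notation T := (measurableTypeR R).
Implicit Types (F G : T -> C) (u v : L2 R).

Definition csq (z : C) : R := complex.Re z ^+ 2 + complex.Im z ^+ 2.

Lemma csq_ge0 z : 0 <= csq z.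
Proof. by rewrite addr_ge0 ?sqr_ge0. Qed.

Lemma csqE z : csq z = normc z ^+ 2.
Proof. by case: z => x y; rewrite /csq /= sqr_sqrtr // addr_ge0 ?sqr_ge0. Qed.

Definition cmeasurable F :=
  measurable_fun setT (@complex.Re R \o F) /\
  measurable_fun setT (@complex.Im R \o F).

Lemma measurable_csq F : cmeasurable F -> measurable_fun setT (csq \o F).
Proof.
by move=> [mr mi]; apply: measurable_funD; exact: measurable_funX.
Qed.

Lemma emeasurable_csq F : cmeasurable F ->
  measurable_fun setT (fun x => (csq (F x))%:E).
Proof. by move=> mF; apply/measurable_EFinP; exact: measurable_csq. Qed.

Lemma powerE (x : R) : ((`|x%:E| `^ 2) = (x ^+ 2)%:E)%E.
Proof.
by rewrite abse_EFin poweR_EFin powR_mulrn ?normr_ge0// real_normK ?num_real.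
Qed.

Lemma LnormE F : ('N[mu]_2%:E[EFin \o (@normc R \o F)] =
  (\int[mu]_x (csq (F x))%:E) `^ 2^-1)%E.
Proof.
rewrite unlock; congr (_ `^ _)%E; apply: eq_integral => x _ /=.
by rewrite csqE powR_mulrn ?normr_ge0// ger0_norm ?normc_ge0.
Qed.

Lemma sq_integrableE F : (F \in @sq_integrable R) <->
  cmeasurable F /\ (\int[mu]_x (csq (F x))%:E < +oo)%E.
Proof.
have I0 : (0 <= \int[mu]_x (csq (F x))%:E)%E.
  by apply: integral_ge0 => x _; rewrite lee_fin csq_ge0.
split=> [/sq_integrableP[mr mi]|[[mr mi] fin]].
  rewrite /finite_norm LnormE => h; split => //.
  by apply: lty_poweRy h; rewrite invr_neq0.
apply/sq_integrableP; split => //; rewrite /finite_norm LnormE.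
exact: poweR_lty.
Qed.

Lemma sqnorm_sqE (f : sqfun R) :
  ((sqnorm f ^+ 2)%:E = \int[mu]_x (csq (f x))%:E)%E.
Proof.
have [_ fin] := (sq_integrableE f).1 (valP f).
have I0 : (0 <= \int[mu]_x (csq (f x))%:E)%E.
  by apply: integral_ge0 => x _; rewrite lee_fin csq_ge0.
have := sqnormE f; rewrite LnormE => e.
rewrite -powerE abse_EFin ger0_norm ?sqnorm_ge0// e -poweRrM mulVf// poweRe1//.
Qed.

Definition rnorm u : R := sqnorm (L2repr u).

Lemma normL2E u : `|u| = (rnorm u)%:C%C. Proof. by []. Qed.

Lemma rnorm_ge0 u : 0 <= rnorm u. Proof. exact: sqnorm_ge0. Qed.

Lemma rnormD u v : rnorm (u + v) <= rnorm u + rnorm v.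
Proof. by rewrite -lecR rmorphD/= -!normL2E ler_normD. Qed.

Lemma rnormZ a u : rnorm (a *: u) = normc a * rnorm u.
Proof.
by have := normrZ a u; rewrite !normL2E -rmorphM => -[].
Qed.

Lemma rnormN u : rnorm (- u) = rnorm u.
Proof. by have := normrN u; rewrite !normL2E => -[]. Qed.

Lemma rnorm0 : rnorm 0 = 0.
Proof. by have := @normr0 _ (L2 R); rewrite normL2E => -[]. Qed.

Lemma rnorm_eq0 u : rnorm u = 0 -> u = 0.
Proof. by move=> h; apply/eqP; rewrite -normr_eq0 normL2E h. Qed.

Lemma L2of_sqnorm (f : sqfun R) : L2of f = L2class f.
Proof. by rewrite /L2of valKd. Qed.

Lemma L2ofE F (hF : F \in @sq_integrable R) : L2of F = L2class (SqFun hF).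
Proof. by rewrite -L2of_sqnorm. Qed.

Lemma L2of_repr u : L2of (L2repr u) = u.
Proof. by rewrite L2of_sqnorm L2reprK. Qed.

Lemma rnorm_sqE F : F \in @sq_integrable R ->
  ((rnorm (L2of F) ^+ 2)%:E = \int[mu]_x (csq (F x))%:E)%E.
Proof. by move=> hF; rewrite L2ofE /rnorm sqnorm_repr sqnorm_sqE. Qed.

Lemma L2ofD F G : F \in @sq_integrable R -> G \in @sq_integrable R ->
  L2of (fun x => F x + G x) = L2of F + L2of G.
Proof.
move=> hF hG; have hFG : (fun x => F x + G x) \in @sq_integrable R.
  exact: (rpredD hF hG).
by rewrite !L2ofE -L2classD; congr L2class; exact/val_inj.
Qed.

Lemma L2ofZ a F : F \in @sq_integrable R ->
  L2of (fun x => a * F x) = a *: L2of F.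
Proof.
move=> hF; have haF : (fun x => a * F x) \in @sq_integrable R.
  exact: (rpredZ a hF).
rewrite !L2ofE -[RHS]/(L2scale a (L2class (SqFun hF))) -L2classZ.
by congr L2class; exact/val_inj.
Qed.

Lemma L2of_eq F G : F \in @sq_integrable R -> G \in @sq_integrable R ->
  {ae mu, forall x, F x = G x} -> L2of F = L2of G.
Proof.
move=> hF hG FG; rewrite !L2ofE; apply/eqP; rewrite L2class_eq; apply/ae_nullP.
apply: (@filterS _ _ (ae_filter_ringOfSetsType mu) _ _ _ FG) => x e.
by rewrite -[LHS]/(F x - G x) e subrr.
Qed.

(** The norm of [L2] takes its values in [R[i]]; this brings the topology back
    to radii in [R]. *)
Lemma closure_rnorm (A : set (L2 R)) u : closure A u <->
  forall e : R, 0 < e -> exists2 v, A v & rnorm (u - v) < e.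
Proof.
split=> [cA e e0|h].
  have e0' : 0 < e%:C%C :> C by rewrite ltcR.
  have [v [Av]] := cA _ (nbhsx_ballx u _ e0').
  by rewrite -ball_normE /= normL2E ltcR => ?; exists v.
move=> B /nbhs_ballP[e /= e0 sB].
have [er e0'] : e = (complex.Re e)%:C%C /\ 0 < complex.Re e.
  move: e0; case: (e) => x y; rewrite ltcE /= => /andP[/eqP -> x0].
  by split.
have [v Av uv] := h _ e0'.
exists v; split => //; apply: sB.
by rewrite -ball_normE /= normL2E er ltcR.
Qed.

Record closed_subspace (V : set (L2 R)) : Prop := ClosedSubspace {
  csub_closed : closure V `<=` V;
  csub0 : V 0;
  csubD : forall u v, V u -> V v -> V (u + v);
  csubZ : forall a u, V u -> V (a *: u) }.

Lemma csubB V u v : closed_subspace V -> V u -> V v -> V (u - v).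
Proof.
move=> hV Vu Vv; apply: csubD => //.
by rewrite -scaleN1r; exact: csubZ.
Qed.

Lemma csub_sum V (I : Type) (r : seq I) (P : pred I) (w : I -> L2 R) :
  closed_subspace V -> (forall i, P i -> V (w i)) ->
  V (\sum_(i <- r | P i) w i).
Proof.
move=> hV Vw; apply: (big_ind V); [exact: csub0|exact: csubD|exact: Vw].
Qed.

Lemma csub_lim V u : closed_subspace V ->
  (forall e : R, 0 < e -> exists2 v, V v & rnorm (u - v) < e) -> V u.
Proof. by move=> hV h; apply: csub_closed hV _ _; exact/closure_rnorm. Qed.

Lemma linear_span_sub (A : set (L2 R)) : A `<=` linear_span A.
Proof.
move=> u Au; exists 1%N, (fun=> 1), (fun=> u); split => //.
by rewrite big_ord1 scale1r.
Qed.

Lemma linear_spanD (A : set (L2 R)) u v :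
  linear_span A u -> linear_span A v -> linear_span A (u + v).
Proof.
move=> [n [k [w [Aw ->]]]] [m [l [z [Az ->]]]].
exists (n + m)%N, (fun i => match fintype.split i with inl i => k i | inr i => l i end),
  (fun i => match fintype.split i with inl i => w i | inr i => z i end); split.
  by move=> i; case: splitP.
rewrite big_split_ord /=; congr (_ + _); apply: eq_bigr => i _.
  by rewrite -[lshift _ _]/(fintype.unsplit (inl i)) unsplitK.
by rewrite -[rshift _ _]/(fintype.unsplit (inr i)) unsplitK.
Qed.

Lemma linear_spanZ (A : set (L2 R)) a u :
  linear_span A u -> linear_span A (a *: u).
Proof.
move=> [n [k [w [Aw ->]]]]; exists n, (fun i => a * k i), w; split => //.
by rewrite scaler_sumr; apply: eq_bigr => i _; rewrite scalerA.
Qed.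

Lemma linear_span0 (A : set (L2 R)) : linear_span A 0.
Proof.
by exists 0%N, (fun=> 0), (fun=> 0); split; [case|rewrite big_ord0].
Qed.

Lemma closed_subspace_closure_span (A : set (L2 R)) :
  closed_subspace (closure (linear_span A)).
Proof.
split.
- exact: closed_closure.
- by apply: subset_closure; exact: linear_span0.
- move=> u v /closure_rnorm hu /closure_rnorm hv; apply/closure_rnorm => e e0.
  have e20 : 0 < e / 2 by rewrite divr_gt0.
  have [u' Au' uu'] := hu _ e20; have [v' Av' vv'] := hv _ e20.
  exists (u' + v'); first exact: linear_spanD.
  rewrite opprD addrACA; apply: le_lt_trans (rnormD _ _) _.
  by rewrite [e]splitr ltrD.
- move=> a u /closure_rnorm hu; apply/closure_rnorm => e e0.
  have a0 : 0 < normc a + 1 by rewrite ltr_wpDl ?normc_ge0.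
  have [v Av uv] := hu _ (divr_gt0 e0 a0).
  exists (a *: v); first exact: linear_spanZ.
  rewrite -scalerBr rnormZ; apply: le_lt_trans (_ : _ <= (normc a + 1) * rnorm (u - v)) _.
    by rewrite ler_wpM2r ?rnorm_ge0// lerDl.
  by rewrite mulrC -ltr_pdivlMr.
Qed.

End square_norms.

(** * The real inner product *)

Section inner_product.
Set Implicit Arguments.
Unset Strict Implicit.
Unset Printing Implicit Defensive.
Context {R : realType}.
Local Notation C := R[i].
Local Notation mu := (muRp R).
Local Notation T := (measurableTypeR R).
Implicit Types (F G : T -> C) (f g : T -> R) (u v w : L2 R).

Definition sqR g :=
  measurable_fun setT g /\ (\int[mu]_x (g x ^+ 2)%:E < +oo)%E.

Lemma integrable_mul f g : sqR f -> sqR g ->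
  mu.-integrable setT (EFin \o (f \* g)).
Proof.
move=> [mf If] [mg Ig].
have m2 (k : T -> R) : measurable_fun setT k ->
    measurable_fun setT (fun x => (k x ^+ 2)%:E).
  by move=> mk; apply/measurable_EFinP; exact: measurable_funX.
apply: (@le_integrable _ _ _ mu _ measurableT _
  (fun x => (f x ^+ 2)%:E + (g x ^+ 2)%:E)%E).
- by apply/measurable_EFinP; exact: measurable_funM.
- move=> x _ /=; rewrite lee_fin normrM [leRHS]ger0_norm; last first.
    by rewrite addr_ge0 ?sqr_ge0.
  rewrite -(real_normK (num_real (f x))) -(real_normK (num_real (g x))).
  by have := normr_ge0 (f x); have := normr_ge0 (g x); nra.
- apply: integrableD => //.
    apply/integrableP; split; first exact: m2.
    by under eq_integral do rewrite abse_EFin ger0_norm ?sqr_ge0//.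
  apply/integrableP; split; first exact: m2.
  by under eq_integral do rewrite abse_EFin ger0_norm ?sqr_ge0//.
Qed.

Lemma sq_integrable_sqR F :
  (F \in @sq_integrable R) <->
  (sqR (@complex.Re R \o F) /\ sqR (@complex.Im R \o F)).
Proof.
have eF : cmeasurable F -> (\int[mu]_x (csq (F x))%:E =
    \int[mu]_x ((complex.Re (F x)) ^+ 2)%:E
    + \int[mu]_x ((complex.Im (F x)) ^+ 2)%:E)%E.
  move=> [mr mi]; rewrite -ge0_integralD//.
  - by move=> x _; rewrite lee_fin sqr_ge0.
  - by apply/measurable_EFinP; exact: measurable_funX.
  - by move=> x _; rewrite lee_fin sqr_ge0.
  - by apply/measurable_EFinP; exact: measurable_funX.
split=> [/sq_integrableE[mF]|[[mr Ir] [mi Ii]]].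
  rewrite eF// => h; have [mr mi] := mF; split; split => //.
    apply: le_lt_trans h; rewrite leeDl// integral_ge0// => x _.
    by rewrite lee_fin sqr_ge0.
  apply: le_lt_trans h; rewrite leeDr// integral_ge0// => x _.
  by rewrite lee_fin sqr_ge0.
by apply/sq_integrableE; split => //; rewrite eF//; exact: lte_add_pinfty.
Qed.

Lemma sqR_Re F : F \in @sq_integrable R -> sqR (@complex.Re R \o F).
Proof. by case/sq_integrable_sqR. Qed.

Lemma sqR_Im F : F \in @sq_integrable R -> sqR (@complex.Im R \o F).
Proof. by case/sq_integrable_sqR. Qed.

Definition ipf F G : R :=
  \int[mu]_x (complex.Re (F x) * complex.Re (G x))
  + \int[mu]_x (complex.Im (F x) * complex.Im (G x)).

(** The real part of the Hermitian inner product. *)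
Definition ip u v : R := ipf (L2repr u) (L2repr v).

Lemma Rintegral_ae f g : mu.-integrable setT (EFin \o f) ->
  mu.-integrable setT (EFin \o g) -> {ae mu, forall x, f x = g x} ->
  \int[mu]_x f x = \int[mu]_x g x.
Proof.
move=> If Ig fg; rewrite /Rintegral; congr fine; apply: ae_eq_integral => //.
- exact: measurable_int If.
- exact: measurable_int Ig.
- by apply: (@filterS _ _ (ae_filter_ringOfSetsType mu) _ _ _ fg) => x -> _.
Qed.

Lemma ip_L2of F G : F \in @sq_integrable R -> G \in @sq_integrable R ->
  ip (L2of F) (L2of G) = ipf F G.
Proof.
move=> hF hG; rewrite /ip /ipf.
have aF := L2of_ae hF; have aG := L2of_ae hG.
have hF' := valP (L2repr (L2of F)); have hG' := valP (L2repr (L2of G)).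
congr (_ + _); apply: Rintegral_ae.
- by apply: (integrable_mul (f := @complex.Re R \o _)
    (g := @complex.Re R \o _)); exact: sqR_Re.
- by apply: (integrable_mul (f := @complex.Re R \o _)
    (g := @complex.Re R \o _)); exact: sqR_Re.
- by apply: (@filterS2 _ _ (ae_filter_ringOfSetsType mu) _ _ _ _ aF aG)
    => x -> ->.
- by apply: (integrable_mul (f := @complex.Im R \o _)
    (g := @complex.Im R \o _)); exact: sqR_Im.
- by apply: (integrable_mul (f := @complex.Im R \o _)
    (g := @complex.Im R \o _)); exact: sqR_Im.
- by apply: (@filterS2 _ _ (ae_filter_ringOfSetsType mu) _ _ _ _ aF aG)
    => x -> ->.
Qed.

Lemma ipC u v : ip u v = ip v u.
Proof.
by rewrite /ip /ipf; congr (_ + _); apply: eq_Rintegral => x _; rewrite mulrC.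
Qed.

Lemma ipDr u v w : ip u (v + w) = ip u v + ip u w.
Proof.
rewrite -[u]L2of_repr -[v]L2of_repr -[w]L2of_repr.
set f := L2repr u; set g := L2repr v; set k := L2repr w.
have [hf hg hk] := And3 (valP f) (valP g) (valP k).
have hgk : (fun x => g x + k x) \in @sq_integrable R by exact: (rpredD hg hk).
rewrite -L2ofD// !ip_L2of// /ipf addrACA.
have mulI (p : C -> R) : (forall F, F \in @sq_integrable R -> sqR (p \o F)) ->
    forall a b : sqfun R, mu.-integrable setT
      (EFin \o (fun x => p (a x) * p (b x))).
  move=> hp a b.
  exact: (integrable_mul (hp _ (valP a)) (hp _ (valP b))).
have eR (p : C -> R) : (forall a b, p (a + b) = p a + p b) ->
    (forall F, F \in @sq_integrable R -> sqR (p \o F)) ->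
  \int[mu]_x (p (f x) * p (g x + k x)) =
  \int[mu]_x (p (f x) * p (g x)) + \int[mu]_x (p (f x) * p (k x)).
  move=> pD hp; rewrite -RintegralD//; [|exact: mulI|exact: mulI].
  by apply: eq_Rintegral => x _; rewrite pD mulrDr.
by rewrite !eR//; [move=> [? ?] []|exact: sqR_Im|move=> [? ?] []|exact: sqR_Re].
Qed.

Lemma ipZr (a : R) u v : ip u (a%:C%C *: v) = a * ip u v.
Proof.
rewrite -[u]L2of_repr -[v]L2of_repr.
set f := L2repr u; set g := L2repr v.
have [hf hg] := conj (valP f) (valP g).
have hag : (fun x => a%:C%C * g x) \in @sq_integrable R.
  exact: (rpredZ (a%:C%C) hg).
rewrite -L2ofZ// !ip_L2of// /ipf mulrDr -!RintegralZl//.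
- congr (_ + _); apply: eq_Rintegral => x _; case: (f x) (g x) => p q [r s] /=.
    by rewrite mul0r subr0; ring.
  by rewrite mul0r addr0; ring.
- by apply: (integrable_mul (f := @complex.Im R \o _)
    (g := @complex.Im R \o _)); exact: sqR_Im.
- by apply: (integrable_mul (f := @complex.Re R \o _)
    (g := @complex.Re R \o _)); exact: sqR_Re.
Qed.

Lemma ipBr u v w : ip u (v - w) = ip u v - ip u w.
Proof.
have -> : - w = (-1)%:C%C *: w by rewrite (rmorphN1 (real_complex R)) scaleN1r.
by rewrite ipDr ipZr mulN1r.
Qed.

Lemma ipBl u v w : ip (u - v) w = ip u w - ip v w.
Proof. by rewrite ipC ipBr !(ipC w). Qed.

Lemma ip0r u : ip u 0 = 0.
Proof. by have := ipBr u 0 0; rewrite subr0 subrr. Qed.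

Lemma ipuu u : ip u u = rnorm u ^+ 2.
Proof.
apply/EFin_inj; rewrite /rnorm sqnorm_sqE /ip /ipf.
set f := L2repr u; have hf := valP f.
have IR := integrable_mul (sqR_Re hf) (sqR_Re hf).
have II := integrable_mul (sqR_Im hf) (sqR_Im hf).
rewrite -RintegralD// /Rintegral fineK//.
apply: integrable_fin_num => //.
exact: (integrableD _ IR II).
Qed.

Lemma rnormB_sq u v (t : R) :
  rnorm (u - t%:C%C *: v) ^+ 2
  = rnorm u ^+ 2 - 2 * t * ip u v + t ^+ 2 * rnorm v ^+ 2.
Proof.
rewrite -!ipuu ipBl !ipBr (ipC (_ *: v)) !ipZr.
rewrite (ipC (_ *: v) v) ipZr.
by ring.
Qed.

Lemma ip_cauchy u v : `|ip u v| <= rnorm u * rnorm v.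
Proof.
have [v0|v0] := eqVneq (rnorm v) 0.
  by rewrite (rnorm_eq0 v0) ip0r normr0 mulr_ge0 ?rnorm_ge0.
have vp : 0 < rnorm v by rewrite lt_def v0 rnorm_ge0.
have := sqr_ge0 (rnorm (u - (ip u v / rnorm v ^+ 2)%:C%C *: v)).
rewrite rnormB_sq => h; rewrite -ler_sqr ?nnegrE ?mulr_ge0 ?rnorm_ge0//.
rewrite real_normK ?num_real// exprMn -ler_pdivrMr ?exprn_gt0// -subr_ge0.
by apply: le_trans h _; rewrite le_eqVlt; apply/orP; left; apply/eqP; field.
Qed.

(** If [u - v] is nearly minimal among the differences of [u] with elements of
    [V], then minimality along each line makes it nearly orthogonal to [V],
    hence, by the hypothesis, to [u] as well; but then it is nearly orthogonal
    to itself. Nearly minimal differences play the part of the orthogonal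
    projection. *)
Lemma csub_weak V u (K : R) : closed_subspace V ->
  (forall r (e : R), 0 <= e -> (forall w, V w -> `|ip r w| <= e * rnorm w) ->
    `|ip r u| <= K * e) ->
  V u.
Proof.
move=> hV hK.
pose D := [set rnorm (u - v) | v in V]; pose d := inf D.
have iD : has_inf D.
  split; first by exists (rnorm (u - 0)), 0 => //; exact: csub0.
  by exists 0 => _ [v _ <-]; exact: rnorm_ge0.
have dle v : V v -> d <= rnorm (u - v).
  by move=> Vv; apply: ge_inf; [case: iD|exists v].
have d0 : 0 <= d by apply: lb_le_inf; [case: iD|move=> _ [v _ <-]; exact: rnorm_ge0].
have dlt (x : R) : d < x -> exists2 v, V v & rnorm (u - v) < x.
  by move=> /(inf_lt iD.1)[_ [v Vv <-] vx]; exists v.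
have main (e : R) : 0 < e <= 1 -> d ^+ 2 <= e * (`|K| + rnorm u + d + 1).
  move=> /andP[e0 e1].
  have [v Vv] : exists2 v, V v & rnorm (u - v) < Num.sqrt (d ^+ 2 + e ^+ 2).
    apply: dlt; rewrite -[X in X < _]ger0_norm// -sqrtr_sqr ltr_sqrt.
      by rewrite ltrDl exprn_gt0.
    by rewrite ltr_wpDl ?sqr_ge0 ?exprn_gt0.
  set r := u - v => rlt.
  have r2 : rnorm r ^+ 2 <= d ^+ 2 + e ^+ 2.
    rewrite -[leRHS]sqr_sqrtr ?addr_ge0 ?sqr_ge0//.
    by rewrite ler_sqr ?nnegrE ?sqrtr_ge0 ?rnorm_ge0// ltW.
  have rw w : V w -> `|ip r w| <= e * rnorm w.
    move=> Vw; have [w0|w0] := eqVneq (rnorm w) 0.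
      by rewrite (rnorm_eq0 w0) ip0r normr0 rnorm0 mulr0.
    have wp : 0 < rnorm w by rewrite lt_def w0 rnorm_ge0.
    have key (t : R) : 2 * t * ip r w <= e ^+ 2 + t ^+ 2 * rnorm w ^+ 2.
      have : d ^+ 2 <= rnorm (r - t%:C%C *: w) ^+ 2.
        rewrite ler_sqr ?nnegrE ?rnorm_ge0// /r -addrA -opprD.
        by apply: dle; apply: csubD => //; exact: csubZ.
      by rewrite rnormB_sq => ?; lra.
    (* the optimal step along [w], up to sign *)
    have k1 := key (e / rnorm w); have k2 := key (- (e / rnorm w)).
    have E : (e / rnorm w) ^+ 2 * rnorm w ^+ 2 = e ^+ 2 by field.
    rewrite sqrrN E in k2; rewrite E in k1.
    have A (x : R) : 2 * (e / rnorm w) * x <= e ^+ 2 + e ^+ 2 ->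
        x <= e * rnorm w.
      move=> h; rewrite -(@ler_pM2l _ (2 * (e / rnorm w))); last first.
        by rewrite mulr_gt0// divr_gt0.
      apply: le_trans h _; rewrite le_eqVlt; apply/orP; left; apply/eqP; by field.
    rewrite ler_norml; apply/andP; split; last exact: A.
    by rewrite lerNl; apply: A; rewrite mulrN -mulNr -mulrN.
  have ru := hK r e (ltW e0) rw.
  have rv := rw v Vv.
  have rle : rnorm r <= d + 1.
    rewrite -ler_sqr ?nnegrE ?rnorm_ge0 ?addr_ge0//; nra.
  have vle : rnorm v <= rnorm u + d + 1.
    have -> : v = u - r by rewrite /r opprB addrC subrK.
    apply: le_trans (rnormD _ _) _; rewrite rnormN; lra.
  have : d ^+ 2 <= ip r u - ip r v.
    rewrite -ipBr -/r ipuu ler_sqr ?nnegrE ?rnorm_ge0//; exact: dle.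
  move: ru rv; rewrite !ler_norml => /andP[_ ru] /andP[rv _] h.
  have := ler_norm K; have := rnorm_ge0 v; nra.
have d_eq0 : d = 0.
  apply/eqP/negPn/negP => dn0.
  have dp : 0 < d by rewrite lt_def dn0.
  pose M := `|K| + rnorm u + d + 1.
  have M0 : 0 < M by rewrite /M ltr_wpDl// !addr_ge0 ?rnorm_ge0.
  pose e := Num.min 1 (d ^+ 2 / (2 * M)).
  have e01 : 0 < e <= 1.
    by rewrite ge_min lexx andbT lt_min ltr01/= divr_gt0 ?exprn_gt0 ?mulr_gt0.
  have := main e e01; rewrite leNgt => /negP; apply.
  have : e * M <= d ^+ 2 / (2 * M) * M by rewrite ler_pM2r// ge_min lexx orbT.
  have -> : d ^+ 2 / (2 * M) * M = d ^+ 2 / 2 by field; rewrite gt_eqF.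
  have : 0 < d ^+ 2 by rewrite exprn_gt0.
  rewrite /M; lra.
apply: csub_lim => // e e0; apply: dlt; by rewrite d_eq0.
Qed.

Lemma scale_complex (a : C) u :
  a *: u = (complex.Re a)%:C%C *: u + (complex.Im a)%:C%C *: ('i%C *: u).
Proof.
rewrite scalerA -scalerDl; congr (_ *: _).
by case: a => x y; simpc.
Qed.

(** Orthogonality to [u] and to [i u] for the real part of the inner product is
    orthogonality for the inner product itself, so this is an orthogonal
    complement over the complex numbers. *)
Lemma closed_subspace_annihilator w :
  closed_subspace [set u | ip w u = 0 /\ ip w ('i%C *: u) = 0].
Proof.
split.
- move=> u /closure_rnorm cu.
  have small (x : R) : (forall e : R, 0 < e -> `|x| <= rnorm w * e) -> x = 0.
    move=> h; apply/eqP/negPn/negP => x0.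
    have w0 : 0 < 2 * (rnorm w + 1) by rewrite mulr_gt0// ltr_wpDl ?rnorm_ge0.
    have xp : 0 < `|x| by rewrite normr_gt0.
    have := h _ (divr_gt0 xp w0); rewrite leNgt => /negP; apply.
    rewrite mulrA ltr_pdivrMr//; have := rnorm_ge0 w; nra.
  split; apply: small => e e0; have [v [v1 v2] uv] := cu e e0.
    have -> : ip w u = ip w (u - v) by rewrite ipBr v1 subr0.
    by apply: le_trans (ip_cauchy _ _) _; rewrite ler_wpM2l ?rnorm_ge0// ltW.
  have -> : ip w ('i%C *: u) = ip w ('i%C *: (u - v)).
    by rewrite scalerBr ipBr v2 subr0.
  apply: le_trans (ip_cauchy _ _) _; rewrite ler_wpM2l ?rnorm_ge0//.
  by rewrite rnormZ /= expr0n expr1n add0r sqrtr1 mul1r ltW.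
- by split; rewrite ?scaler0 ip0r.
- by move=> u v [u1 u2] [v1 v2]; split; rewrite ?scalerDr ipDr ?u1 ?u2 ?v1 ?v2 addr0.
- move=> a u [u1 u2]; split.
    by rewrite scale_complex ipDr !ipZr u1 u2 !mulr0 addr0.
  have -> : 'i%C *: (a *: u) =
      (complex.Re a)%:C%C *: ('i%C *: u) + (- complex.Im a)%:C%C *: u.
    rewrite !scalerA -scalerDl; congr (_ *: _).
    by case: a => x y; simpc.
  by rewrite ipDr !ipZr u1 u2 !mulr0 addr0.
Qed.

End inner_product.

(** * Real functions and dominated convergence *)

Section real_functions.
Set Implicit Arguments.
Unset Strict Implicit.
Unset Printing Implicit Defensive.
Context {R : realType}.
Local Notation C := R[i].
Local Notation mu := (muRp R).
Local Notation T := (measurableTypeR R).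
Implicit Types (f g G : T -> R) (V : set (L2 R)).

Definition emb g : L2 R := L2of (fun x => (g x)%:C%C).

Lemma measurable_lt_indic (a : R) :
  measurable_fun setT (fun x : T => (x < a)%R%:R : R).
Proof.
rewrite (_ : (fun _ => _) = (fun x : T => if x < a then 1 else 0 : R)).
  by apply: measurable_fun_ifT => //; exact: measurable_fun_ltr.
by apply/funext => x; case: ifP.
Qed.

Lemma measurable_le_indic (c : R) :
  measurable_fun setT (fun x : T => (x <= c)%R%:R : R).
Proof.
rewrite (_ : (fun _ => _) = (fun x : T => if x <= c then 1 else 0 : R)).
  by apply: measurable_fun_ifT => //; exact: measurable_fun_ler.
by apply/funext => x; case: ifP.
Qed.

Lemma measurable_ge0_indic : measurable_fun setT (fun x : T => (0 <= x)%R%:R : R).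
Proof.
rewrite (_ : (fun _ => _) = (fun x : T => if 0 <= x then 1 else 0 : R)).
  by apply: measurable_fun_ifT => //; exact: measurable_fun_ler.
by apply/funext => x; case: ifP.
Qed.

Lemma muRp_ae_ge0 (P : R -> Prop) : (forall x, 0 <= x -> P x) ->
  {ae mu, forall x, P x}.
Proof.
move=> h; exists `]-oo, (0:R)[%classic; split => //.
- rewrite /muRp/= /mrestr.
  rewrite (_ : _ `&` _ = set0) ?measure0//.
  by apply/seteqP; split => x //=; rewrite !in_itv/= andbT ltNge => -[/negP].
- move=> x /= nPx; rewrite in_itv/= ltNge; apply/negP => x0; exact/nPx/h.
Qed.

Lemma ae_muRp_leb (P : R -> Prop) :
  {ae @lebesgue_measure R, forall x, P x} -> {ae mu, forall x, P x}.
Proof.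
move=> [A [mA A0 sub]]; exists A; split => //.
apply/eqP; rewrite eq_le measure_ge0 andbT -A0 /muRp/= /mrestr.
by apply: le_measure; rewrite ?inE//; exact: measurableI.
Qed.

Lemma ae_muRp_neq (a : R) : {ae mu, forall x, x <> a}.
Proof.
apply: ae_muRp_leb; exists [set a]; split => //.
  by rewrite lebesgue_measure_set1.
by move=> x /= /contrapT ->.
Qed.

Lemma sqR_emb g : sqR g <-> (fun x : R => (g x)%:C%C) \in @sq_integrable R.
Proof.
split=> [hg|/sqR_Re//].
apply/sq_integrable_sqR; split; first exact: hg.
split; first by rewrite (_ : _ \o _ = cst 0).
by under eq_integral do rewrite /= expr0n/=; rewrite integral0.
Qed.

Lemma sqR_le f G : measurable_fun setT f -> sqR G ->
  (forall x, 0 <= x -> `|f x| <= G x) -> sqR f.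
Proof.
move=> mf [mG IG] fG; split => //; apply: le_lt_trans IG.
apply: ae_ge0_le_integral => //.
- by move=> x _; rewrite lee_fin sqr_ge0.
- by apply/measurable_EFinP; exact: measurable_funX.
- by move=> x _; rewrite lee_fin sqr_ge0.
- by apply/measurable_EFinP; exact: measurable_funX.
- apply: muRp_ae_ge0 => x x0 _; rewrite lee_fin -real_normK ?num_real//.
  by rewrite ler_sqr ?nnegrE ?fG// (le_trans _ (fG x x0)).
Qed.

Lemma sqR_normr f : sqR f -> sqR (fun x => `|f x|).
Proof.
move=> [mf If]; split; first exact: measurableT_comp.
by under eq_integral do rewrite real_normK ?num_real//.
Qed.

Lemma sqRD f g : sqR f -> sqR g -> sqR (fun x => f x + g x).
Proof.
move=> /sqR_emb hf /sqR_emb hg; apply/sqR_emb.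
rewrite (_ : (fun _ => _) = (fun x : R => (f x)%:C%C) + (fun x => (g x)%:C%C)).
  exact: rpredD.
by apply/funext => x; rewrite fctE rmorphD.
Qed.

Lemma sqRZ (a : R) f : sqR f -> sqR (fun x => a * f x).
Proof.
move=> /sqR_emb hf; apply/sqR_emb.
rewrite (_ : (fun _ => _) = a%:C%C *: (fun x : R => (f x)%:C%C)).
  exact: rpredZ.
by apply/funext => x; rewrite rmorphM.
Qed.

Lemma sqRB f g : sqR f -> sqR g -> sqR (fun x => f x - g x).
Proof.
move=> hf /(sqRZ (-1)) hg.
rewrite (_ : (fun _ => _) = (fun x => f x + -1 * g x)); first exact: sqRD.
by apply/funext => x; rewrite mulN1r.
Qed.

Lemma embD f g : sqR f -> sqR g -> emb (fun x => f x + g x) = emb f + emb g.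
Proof.
move=> /sqR_emb hf /sqR_emb hg; rewrite /emb -L2ofD//; congr L2of.
by apply/funext => x; rewrite rmorphD.
Qed.

Lemma embZ (a : R) f : sqR f -> emb (fun x => a * f x) = a%:C%C *: emb f.
Proof.
move=> /sqR_emb hf; rewrite /emb -L2ofZ//; congr L2of.
by apply/funext => x; rewrite rmorphM.
Qed.

Lemma embB f g : sqR f -> sqR g -> emb (fun x => f x - g x) = emb f - emb g.
Proof.
move=> hf hg; rewrite -[- emb g]scaleN1r -(rmorphN1 (real_complex R)) -embZ//.
rewrite -embD//; last exact: sqRZ.
by congr emb; apply/funext => x; rewrite mulN1r.
Qed.

Lemma rnorm_embE f : sqR f ->
  ((rnorm (emb f) ^+ 2)%:E = \int[mu]_x (f x ^+ 2)%:E)%E.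
Proof.
move=> hf; rewrite rnorm_sqE; last exact/sqR_emb.
by apply: eq_integral => x _; rewrite /csq/= expr0n/= addr0.
Qed.

(** Every limit of explicit functions below is taken in this form: a closed
    subspace is stable under dominated pointwise convergence. *)
Lemma csub_dominated V (g_ : nat -> T -> R) g G :
  closed_subspace V -> sqR G ->
  (forall n, measurable_fun setT (g_ n)) -> measurable_fun setT g ->
  (forall n x, 0 <= x -> `|g_ n x| <= G x) ->
  {ae mu, forall x, g_ ^~ x @ \oo --> g x} ->
  (forall n, V (emb (g_ n))) -> V (emb g).
Proof.
move=> hV hG mg_ mg gG gg Vg.
have hg_ n : sqR (g_ n) by apply: (sqR_le (mg_ n) hG) => x; exact: gG.
have gle : {ae mu, forall x, `|g x| <= G x}.
  have A := muRp_ae_ge0 (P := fun x => forall n, `|g_ n x| <= G x)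
    (fun x x0 n => gG n x x0).
  apply: (@filterS2 _ _ (ae_filter_ringOfSetsType mu) _ _ _ _ gg A).
  move=> x gx gGx; have h : (fun n => `|g_ n x|) @ \oo --> `|g x| by exact: cvg_norm.
  rewrite -(cvg_lim (@Rhausdorff R) h); apply: limr_le.
    by apply/cvg_ex; exists `|g x|.
  by apply: nearW => n; exact: gGx.
have hg : sqR g.
  split => //; apply: le_lt_trans (hG.2).
  apply: ae_ge0_le_integral => //.
  - by move=> x _; rewrite lee_fin sqr_ge0.
  - by apply/measurable_EFinP; exact: measurable_funX.
  - by move=> x _; rewrite lee_fin sqr_ge0.
  - by apply/measurable_EFinP; apply: measurable_funX; exact: hG.1.
  - apply: (@filterS _ _ (ae_filter_ringOfSetsType mu) _ _ _ gle) => x gx _.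
    rewrite lee_fin -real_normK ?num_real//.
    by rewrite ler_sqr ?nnegrE// (le_trans _ gx).
apply: csub_lim => // e e0.
pose h n x : \bar R := ((g x - g_ n x) ^+ 2)%:E.
have mh n : measurable_fun setT (h n).
  by apply/measurable_EFinP; apply: measurable_funX; exact: measurable_funB.
have [_ _] : [/\ mu.-integrable setT (cst 0%E : T -> \bar R),
   [sequence \int[mu]_x `|h n x - cst 0 x|]_n @ \oo --> 0%E &
   [sequence \int[mu]_x (h n x)]_n @ \oo --> \int[mu]_x (cst 0 x : \bar R)]%E.
  apply: (@dominated_convergence _ T R mu setT measurableT _ _
    (fun x => (4 * (G x ^+ 2))%:E)) => //.
  - apply: (@filterS _ _ (ae_filter_ringOfSetsType mu) _ _ _ gg) => x gx _.
    apply: cvg_EFin; first exact: nearW.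
    have -> : 0 = (g x - g x) ^+ 2 by rewrite subrr expr0n.
    rewrite (_ : _ \o _ = (fun n => (g x - g_ n x) * (g x - g_ n x))).
      by apply: cvgM; apply: cvgB => //; exact: cvg_cst.
    by apply/funext => n.
  - apply/integrableP; split.
      apply/measurable_EFinP; apply: measurable_funM => //.
      by apply: measurable_funX; exact: hG.1.
    rewrite (eq_integral (fun x => 4%:E * (G x ^+ 2)%:E)%E); last first.
      by move=> x _; rewrite abse_EFin ger0_norm ?EFinM// mulr_ge0 ?sqr_ge0.
    rewrite ge0_integralZl//.
    + by rewrite lte_mul_pinfty//; exact: hG.2.
    + by apply/measurable_EFinP; apply: measurable_funX; exact: hG.1.
    + by move=> x _; rewrite lee_fin sqr_ge0.
  - have A := muRp_ae_ge0 (P := fun x => forall n, `|g_ n x| <= G x)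
      (fun x x0 n => gG n x x0).
    apply: (@filterS2 _ _ (ae_filter_ringOfSetsType mu) _ _ _ _ gle A).
    move=> x gx gGx n _; rewrite /h abse_EFin lee_fin ger0_norm ?sqr_ge0//.
    have -> : 4 * G x ^+ 2 = (2 * G x) ^+ 2 by ring.
    rewrite -real_normK ?num_real// ler_sqr ?nnegrE//.
      apply: le_trans (ler_normB _ _) _.
      by have := gGx n; lra.
    by rewrite mulr_ge0// (le_trans _ gx).
rewrite integral0 => /fine_cvgP[_ /cvgrPdist_lt /(_ _ (exprn_gt0 2 e0))[N _ hN]].
exists (emb (g_ N)) => //.
have := hN N (leqnn N); rewrite /= sub0r normrN.
rewrite -embB// -rnorm_embE/=; last exact: sqRB.
rewrite ger0_norm ?sqr_ge0//.
by rewrite ltr_sqr ?nnegrE ?rnorm_ge0 ?ltW.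
Qed.

Lemma csub_emb_sum V (I : Type) (r : seq I) (h : I -> T -> R) :
  closed_subspace V -> (forall i, sqR (h i)) -> (forall i, V (emb (h i))) ->
  sqR (fun x => \sum_(i <- r) h i x) /\ V (emb (fun x => \sum_(i <- r) h i x)).
Proof.
move=> hV sh Vh.
have sq0 : sqR (fun=> 0 : R).
  by apply/sqR_emb; exact: (rpred0 (@sq_integrable R)).
elim: r => [|i r [IH1 IH2]].
  under [X in sqR X]eq_fun do rewrite big_nil.
  under [X in emb X]eq_fun do rewrite big_nil.
  split => //; have -> : (fun=> 0) = (fun x : T => 0 * (fun=> 0 : R) x).
    by apply/funext => x; rewrite mul0r.
  by rewrite embZ// scale0r; exact: csub0.
under [X in sqR X]eq_fun do rewrite big_cons.
under [X in emb X]eq_fun do rewrite big_cons.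
split; first exact: sqRD.
by rewrite embD//; exact: csubD.
Qed.

End real_functions.

(** * Exponentials with nearby exponents *)

Section exponentials.
Set Implicit Arguments.
Unset Strict Implicit.
Unset Printing Implicit Defensive.
Context {R : realType}.
Local Notation C := R[i].
Local Notation mu := (muRp R).
Local Notation T := (measurableTypeR R).
Implicit Types (f g G : T -> R) (V : set (L2 R)) (l a b x : R) (n : nat).

Definition expo l : T -> R := fun x => expR (- (l * x)).

Definition mono n l : T -> R := fun x => x ^+ n * expo l x.

Lemma measurable_expo l : measurable_fun setT (expo l).
Proof.
apply: measurableT_comp; first exact: measurable_expR.
by apply: measurable_funN; exact: measurable_funM.
Qed.

Lemma measurable_mono n l : measurable_fun setT (mono n l).
Proof.
by apply: measurable_funM; [exact: measurable_funX|exact: measurable_expo].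
Qed.

Lemma sqR_expo l : 0 < l -> sqR (expo l).
Proof.
move=> l0; split; first exact: measurable_expo.
have l20 : 0 < 2 * l by rewrite mulr_gt0.
apply: (@le_lt_trans _ _ (\int[@lebesgue_measure R]_x
  ((2 * l)^-1%:E * (exponential_pdf (2 * l) x)%:E))%E).
  apply: (@le_trans _ _ (\int[mu]_x
    ((2 * l)^-1%:E * (exponential_pdf (2 * l) x)%:E))%E).
    apply: ae_ge0_le_integral => //.
    - by move=> x _; rewrite lee_fin sqr_ge0.
    - by apply/measurable_EFinP; apply: measurable_funX; exact: measurable_expo.
    - move=> x _; rewrite -EFinM lee_fin mulr_ge0 ?exponential_pdf_ge0 ?invr_ge0 ?ltW//.
    - apply/measurable_EFinP; apply: measurable_funM => //.
      exact: measurable_exponential_pdf.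
    - apply: muRp_ae_ge0 => x x0 _; rewrite -EFinM lee_fin.
      rewrite exponential_pdfE// mulrA mulVf ?gt_eqF// mul1r /expo -expRM_natl.
      by rewrite ler_expR; lra.
  apply: ge0_le_measure_integral => //.
  - move=> A mA; rewrite /muRp/= /mrestr.
    by apply: le_measure; rewrite ?inE//; exact: measurableI.
  - move=> x; rewrite -EFinM lee_fin mulr_ge0 ?exponential_pdf_ge0 ?invr_ge0 ?ltW//.
  - apply/measurable_EFinP; apply: measurable_funM => //.
    exact: measurable_exponential_pdf.
rewrite ge0_integralZl//.
- by rewrite integral_exponential_pdf// mule1 ltry.
- by apply/measurable_EFinP; exact: measurable_exponential_pdf.
- by move=> x _; rewrite lee_fin exponential_pdf_ge0// ltW.
- by rewrite lee_fin invr_ge0 ltW.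
Qed.

Lemma expo_gt0 l x : 0 < expo l x. Proof. exact: expR_gt0. Qed.

Lemma expr_le_expR n x : 0 <= x -> x ^+ n <= n`!%:R * expR x.
Proof.
move=> x0; case: n => [|n].
  by rewrite expr0 fact0 mul1r -expR0 ler_expR.
have f0 : 0 < n.+1`!%:R :> R by rewrite ltr0n fact_gt0.
rewrite mulrC -ler_pdivrMr//; apply: le_trans (expR_ge1Dxn n x0).
by rewrite lerDr.
Qed.

Lemma sqR_mono n l : 0 < l -> sqR (mono n l).
Proof.
move=> l0; pose d := l / 2; have d0 : 0 < d by rewrite divr_gt0.
apply: (@sqR_le _ _ (fun x => (n`!%:R / d ^+ n) * expo d x)).
- exact: measurable_mono.
- exact/sqRZ/sqR_expo.
- move=> x x0; rewrite /mono normrM (gtr0_norm (expo_gt0 _ _)).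
  rewrite ger0_norm ?exprn_ge0// -ler_pdivlMr ?expo_gt0//.
  have E : expo d x / expo l x = expR (l * x - d * x).
    by rewrite /expo -expRB; congr expR; ring.
  rewrite -[_ * expo d x / _]mulrA E mulrAC ler_pdivlMr ?exprn_gt0// -exprMn.
  apply: le_trans (expr_le_expR n _) _; first exact: mulr_ge0 x0 (ltW d0).
  rewrite ler_pM2l ?ltr0n ?fact_gt0// ler_expR.
  have -> : l = d + d by rewrite /d -splitr.
  lra.
Qed.

Lemma cvg_sum_expR x :
  (fun N => \sum_(n < N) x ^+ n / n`!%:R) @ \oo --> expR x.
Proof.
rewrite (_ : (fun _ => _) = series (exp_coeff x)).
  exact: (is_cvg_series_exp_coeff x).
by apply/funext => N; rewrite /series/= big_mkord.
Qed.

Lemma sum_le_expR x N : 0 <= x -> \sum_(n < N) x ^+ n / n`!%:R <= expR x.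
Proof.
move=> x0; have h := cvg_sum_expR (x := x).
have nd : nondecreasing_seq (fun N => \sum_(n < N) x ^+ n / n`!%:R).
  apply/nondecreasing_seqP => m; rewrite big_ord_recr/= lerDl.
  by rewrite divr_ge0 ?exprn_ge0.
rewrite -(cvg_lim (@Rhausdorff R) h).
by apply: nondecreasing_cvgn_le => //; apply/cvg_ex; exists (expR x).
Qed.

Lemma expRN_bounds x : 0 <= x -> x - x ^+ 2 <= 1 - expR (- x) <= x.
Proof.
move=> x0; have := expR_ge1Dx (- x); have := expR_ge1Dx x.
rewrite expRN => h1 h2; apply/andP; split; last lra.
have : (expR x)^-1 <= (1 + x)^-1.
  by rewrite lef_pV2 ?posrE ?expR_gt0//; lra.
have : (1 + x)^-1 <= 1 - x + x ^+ 2.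
  rewrite -[leLHS]mul1r ler_pdivrMr; last lra.
  have : 0 <= x ^+ 3 by rewrite exprn_ge0.
  by rewrite (_ : (1 - x + x ^+ 2) * (1 + x) = 1 + x ^+ 3); [lra|ring].
lra.
Qed.

(** Up to sign, [mono n.+1 l] is the derivative of [mono n l] in the exponent
    [l], and the difference quotients converge in [L2]: since
    [u - u ^+ 2 <= 1 - expR (- u) <= u] for [0 <= u], they are dominated by
    [mono n.+1 l]. *)
Lemma csub_mono V a b : closed_subspace V -> 0 <= a ->
  (forall l, a < l < b -> V (emb (expo l))) ->
  forall n l, a < l < b -> V (emb (mono n l)).
Proof.
move=> hV a0 Ve; elim=> [|n IH] l /andP[al lb].
  rewrite (_ : mono 0 l = expo l); first by apply: Ve; rewrite al.
  by apply/funext => x; rewrite /mono expr0 mul1r.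
have l0 : 0 < l by exact: le_lt_trans al.
pose h k : R := (b - l) / 2 / k.+1%:R.
have h0 k : 0 < h k by rewrite !divr_gt0// subr_gt0.
have hb k : l + h k < b.
  rewrite -ltrBrDl; apply: le_lt_trans (_ : _ <= (b - l) / 2) _.
    rewrite /h ler_pdivrMr// ler_peMr ?ler1n//.
    by rewrite divr_ge0// subr_ge0 ltW.
  by rewrite ltr_pdivrMr// ltr_pMr ?subr_gt0// ltr1n.
have hl : h @ \oo --> 0.
  rewrite -[X in _ --> X](mulr0 ((b - l) / 2)).
  by apply: cvgM; [exact: cvg_cst|exact: cvg_harmonic].
pose q k x := (h k)^-1 * (mono n l x - mono n (l + h k) x).
have qE k x : q k x = mono n l x * ((1 - expR (- (h k * x))) / h k).
  rewrite /q /mono /expo mulrDl opprD expRD; ring.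
have qb k x : 0 <= x ->
    x - h k * x ^+ 2 <= (1 - expR (- (h k * x))) / h k <= x.
  move=> x0; rewrite ler_pdivlMr// ler_pdivrMr//.
  have := expRN_bounds (mulr_ge0 (ltW (h0 k)) x0).
  move=> /andP[A B]; apply/andP; split.
    by apply: le_trans A; rewrite le_eqVlt; apply/orP; left; apply/eqP; ring.
  by rewrite [leRHS]mulrC.
apply: (csub_dominated (g_ := q) (G := mono n.+1 l)) => //.
- exact: sqR_mono.
- move=> k; apply: measurable_funM => //.
  by apply: measurable_funB; exact: measurable_mono.
- exact: measurable_mono.
- move=> k x x0; rewrite qE normrM.
  have m0 : 0 <= mono n l x by rewrite mulr_ge0 ?exprn_ge0 ?expR_ge0.
  rewrite (ger0_norm m0) /mono exprSr -[leRHS]mulrA [x * _]mulrC mulrA.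
  rewrite ler_wpM2l// ger0_norm; first by case/andP: (qb k x x0).
  rewrite divr_ge0 ?(ltW (h0 k))// subr_ge0 -expR0 ler_expR oppr_le0.
  by rewrite mulr_ge0// ltW.
- apply: muRp_ae_ge0 => x x0.
  rewrite (_ : q ^~ x =
    (fun k => mono n l x * ((1 - expR (- (h k * x))) / h k))); last first.
    by apply/funext => k; rewrite qE.
  rewrite (_ : mono n.+1 l x = mono n l x * x); last first.
    by rewrite /mono exprSr -!mulrA [x * _]mulrC.
  apply: cvgM; first exact: cvg_cst.
  apply: (@squeeze_cvgr _ _ _ _ (fun k => x - h k * x ^+ 2) (cst x)).
  + by apply: nearW => k; exact: qb.
  + rewrite -[X in _ --> X]subr0 -[X in _ - X](mul0r (x ^+ 2)).
    by apply: cvgB; [exact: cvg_cst|apply: cvgM => //; exact: cvg_cst].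
  + exact: cvg_cst.
- move=> k; rewrite /q.
  have s1 : sqR (mono n l) by exact: sqR_mono.
  have s2 : sqR (mono n (l + h k)) by apply: sqR_mono; exact: addr_gt0.
  rewrite embZ; last exact: sqRB.
  apply: csubZ => //; rewrite embB//; apply: csubB => //; first by apply: IH; rewrite al.
  by apply: IH; rewrite hb andbT (lt_trans al)// ltrDl.
Qed.

(** The Taylor series of [m |-> expo m] at [l] is dominated by
    [expo (l - `|l - m|)], which is square integrable exactly when
    [`|l - m| < l]. *)
Lemma csub_expo_taylor V l m : closed_subspace V ->
  (forall n, V (emb (mono n l))) -> 0 < m < 2 * l -> V (emb (expo m)).
Proof.
move=> hV Vm /andP[m0 ml].
have l0 : 0 < l by lra.
pose d := l - `|l - m|.
have d0 : 0 < d.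
  rewrite /d subr_gt0 lter_norml; apply/andP; split; lra.
pose s N x := \sum_(n < N) ((l - m) ^+ n / n`!%:R) * mono n l x.
have sE N x : s N x = expo l x * \sum_(n < N) ((l - m) * x) ^+ n / n`!%:R.
  rewrite mulr_sumr; apply: eq_bigr => n _; rewrite /mono exprMn; ring.
have Vs N : sqR (s N) /\ V (emb (s N)).
  apply: csub_emb_sum => // n; first exact/sqRZ/sqR_mono.
  by rewrite embZ; [exact: csubZ|exact: sqR_mono].
apply: (csub_dominated (g_ := s) (G := expo d)) => //.
- exact: sqR_expo.
- by move=> N; case: (Vs N) => -[].
- exact: measurable_expo.
- move=> N x x0; rewrite sE normrM (gtr0_norm (expo_gt0 _ _)).
  apply: le_trans (_ : _ <= expo l x * expR (`|l - m| * x)) _.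
    rewrite ler_pM2l ?expo_gt0//; apply: le_trans (ler_norm_sum _ _ _) _.
    apply: le_trans (sum_le_expR N (mulr_ge0 (normr_ge0 _) x0)).
    apply: ler_sum => n _; rewrite normrM normrX normrM (ger0_norm x0).
    by rewrite [X in _ * X]ger0_norm// invr_ge0.
  by rewrite /expo -expRD ler_expR /d; lra.
- apply: aeW => x; rewrite (_ : s ^~ x =
    (fun N => expo l x * \sum_(n < N) ((l - m) * x) ^+ n / n`!%:R)); last first.
    by apply/funext => N; rewrite sE.
  rewrite (_ : expo m x = expo l x * expR ((l - m) * x)); last first.
    by rewrite /expo -expRD; congr expR; ring.
  by apply: cvgM; [exact: cvg_cst|exact: cvg_sum_expR].
- by move=> N; case: (Vs N).
Qed.

(** Taylor expansion at a point close to the right end of an interval of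
    admissible exponents reaches almost twice as far, and down to [0]; so the
    interval can be enlarged by a factor [3 / 2] again and again. *)
Lemma csub_expo_all V a b : closed_subspace V -> 0 <= a -> a < b ->
  (forall l, a < l < b -> V (emb (expo l))) ->
  forall l, 0 < l -> V (emb (expo l)).
Proof.
move=> hV a0 ab Ve.
have b0 : 0 < b by exact: le_lt_trans ab.
have main n l : 0 < l < b * (3 / 2) ^+ n -> V (emb (expo l)).
  elim: n l => [|n IH] l.
    rewrite expr0 mulr1 => /andP[l0 lb].
    pose k := Num.max ((a + b) / 2) ((l + b) / 2).
    have k1 : (a + b) / 2 <= k by rewrite le_max lexx.
    have k2 : (l + b) / 2 <= k by rewrite le_max lexx orbT.
    have kb : k < b by rewrite gt_max; apply/andP; split; lra.
    apply: (@csub_expo_taylor _ k) => //; last by rewrite l0/=; lra.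
    by move=> n; apply: (csub_mono hV a0 Ve); rewrite kb andbT; lra.
  set B := b * (3 / 2) ^+ n in IH.
  have B0 : 0 < B by rewrite mulr_gt0// exprn_gt0//; lra.
  have -> : b * (3 / 2) ^+ n.+1 = B * (3 / 2) by rewrite exprSr /B; ring.
  move=> /andP[l0 lB]; clearbody B.
  apply: (@csub_expo_taylor _ (3 / 4 * B)) => //; last by rewrite l0/=; lra.
  move=> m; apply: (@csub_mono _ 0 B) => //; apply/andP; split; lra.
move=> l l0.
have [n hn] : exists n, l / b < (3 / 2) ^+ n.
  have : (fun n => (2 / 3 : R) ^+ n) @ \oo --> 0.
    by apply: cvg_expr; rewrite ger0_norm; lra.
  have lb0 : 0 < b / l by rewrite divr_gt0.
  move=> /cvgrPdist_lt/(_ _ lb0)[n _ /(_ n (leqnn n))].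
  have q0 : (0 : R) <= 2 / 3 by lra.
  rewrite /= sub0r normrN ger0_norm ?exprn_ge0// => h; exists n.
  rewrite -[ltRHS]invrK -exprVn invf_div -[ltLHS]invrK invf_div ltf_pV2//.
  by rewrite posrE exprn_gt0//; lra.
by apply: (main n); rewrite l0/= mulrC -ltr_pdivrMr.
Qed.

End exponentials.

(** * Density of the exponentials *)

Section density.
Import HBSimple HBNNSimple.
Set Implicit Arguments.
Unset Strict Implicit.
Unset Printing Implicit Defensive.
Context {R : realType}.
Local Notation C := R[i].
Local Notation mu := (muRp R).
Local Notation T := (measurableTypeR R).
Implicit Types (f g G : T -> R) (V : set (L2 R)) (l a b x : R) (n : nat).

(** The double exponential is a smoothed indicator of [x < a] which is also a
    series of exponentials; this is how indicators are reached. *)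
Definition gumbel a n : T -> R := fun x => 1 - expR (- expR (a - x) ^+ n.+1).

Lemma measurable_gumbel a n : measurable_fun setT (gumbel a n).
Proof.
apply: measurable_funB => //; apply: measurableT_comp => //.
apply: measurable_funN; apply: measurable_funX.
apply: measurableT_comp => //; exact: measurable_funB.
Qed.

(** With [u = U * expo n.+1 x], the power series of [1 - expR (- u)] has as its
    terms multiples of [expo (n.+1 * k.+1) x], and its partial sums are
    dominated by [expR u - 1 <= u * expR U]. *)
Lemma csub_gumbel V a n : closed_subspace V ->
  (forall l, 0 < l -> V (emb (expo l))) -> V (emb (gumbel a n)).
Proof.
move=> hV Ve.
pose U := expR a ^+ n.+1; have U0 : 0 < U by rewrite exprn_gt0// expR_gt0.
pose u x := U * expo n.+1%:R x.
have uE x : expR (a - x) ^+ n.+1 = u x.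
  by rewrite /u /U /expo -!expRM_natl -expRD; congr expR; ring.
have u0 x : 0 <= u x by rewrite mulr_ge0 ?(ltW U0)// expR_ge0.
pose c k := - ((- U) ^+ k.+1 / k.+1`!%:R).
pose s K x := \sum_(k < K) c k * expo (n.+1 * k.+1)%N%:R x.
have eX k x : expo (n.+1 * k.+1)%N%:R x = expo n.+1%:R x ^+ k.+1.
  by rewrite /expo -expRM_natl natrM; congr expR; ring.
have tE k x : c k * expo (n.+1 * k.+1)%N%:R x = - ((- u x) ^+ k.+1 / k.+1`!%:R).
  have -> : - u x = - U * expo n.+1%:R x by rewrite mulNr.
  by rewrite eX /c exprMn mulNr mulrAC.
have sE K x : s K x = 1 - \sum_(k < K.+1) (- u x) ^+ k / k`!%:R.
  rewrite big_ord_recl/= expr0 fact0 divr1 opprD addrA subrr sub0r.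
  by rewrite -sumrN; apply: eq_bigr => k _; rewrite tE.
have l0 k : 0 < (n.+1 * k.+1)%N%:R :> R by rewrite ltr0n.
have Vs K : sqR (s K) /\ V (emb (s K)).
  apply: csub_emb_sum => // k; first exact/sqRZ/sqR_expo.
  by rewrite embZ; [apply: csubZ => //; exact: Ve|exact: sqR_expo].
apply: (csub_dominated (g_ := s) (G := fun x => U * expR U * expo n.+1%:R x)) => //.
- by apply/sqRZ/sqR_expo; rewrite ltr0n.
- by move=> K; case: (Vs K) => -[].
- exact: measurable_gumbel.
- move=> K x x0; apply: le_trans (_ : _ <= expR (u x) - 1) _.
    have -> : expR (u x) - 1 = expR (u x) - (u x) ^+ 0 / 0`!%:R.
      by rewrite expr0 fact0 divr1.
    rewrite lerBrDr; apply: le_trans (sum_le_expR K.+1 (u0 x)).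
    rewrite big_ord_recl addrC lerD2l; apply: le_trans (ler_norm_sum _ _ _) _.
    apply: ler_sum => k _; rewrite tE normrN normrM normrX normrN (ger0_norm (u0 x)).
    by rewrite ger0_norm ?invr_ge0.
  have uU : u x <= U.
    rewrite /u -[leRHS]mulr1 ler_pM2l// -expR0 ler_expR oppr_le0.
    by rewrite mulr_ge0.
  apply: le_trans (_ : _ <= u x * expR (u x)) _.
    have /andP[_] := expRN_bounds (u0 x).
    rewrite -(ler_pM2r (expR_gt0 (u x))) mulrBl mul1r expRN mulVf//.
    by rewrite gt_eqF// expR_gt0.
  rewrite /u -!mulrA ler_pM2l// [expR U * _]mulrC ler_pM2l ?expR_gt0//.
  by rewrite ler_expR.
- apply: aeW => x; rewrite /gumbel uE.
  rewrite (_ : s ^~ x = (fun K => 1 - \sum_(k < K.+1) (- u x) ^+ k / k`!%:R)).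
    apply: cvgB; first exact: cvg_cst.
    have := @cvg_sum_expR _ (- u x).
    by rewrite -(cvg_shiftS (fun K => \sum_(k < K) (- u x) ^+ k / k`!%:R)).
  by apply/funext => K; rewrite sE.
- by move=> K; case: (Vs K).
Qed.

Lemma sqR_cut g a : measurable_fun setT g -> (forall x, 0 <= g x <= 1) ->
  sqR (fun x => g x * (x < a)%R%:R).
Proof.
move=> mg g01; apply: (@sqR_le _ _ (fun x => expR a * expo 1 x)).
- by apply: measurable_funM => //; exact: measurable_lt_indic.
- exact/sqRZ/sqR_expo.
- move=> x x0; have /andP[gx0 gx1] := g01 x.
  rewrite normrM (ger0_norm gx0) ger0_norm ?ler0n//.
  apply: le_trans (_ : _ <= (x < a)%R%:R) _; first by rewrite ler_piMl ?ler0n.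
  rewrite /expo -expRD mul1r; case: ltP => [xa|_]; last exact: expR_ge0.
  by rewrite -expR0 ler_expR subr_ge0 ltW.
Qed.

Lemma sqR_lt a : sqR (fun x => (x < a)%R%:R).
Proof.
have := @sqR_cut (cst 1) a (measurable_cst _) _.
rewrite (_ : (fun _ => _) = fun x : T => (x < a)%R%:R); first by apply => x; rewrite ler01 lexx.
by apply/funext => x; rewrite mul1r.
Qed.

(** Away from [a], [expR (a - x) ^+ n.+1] goes to [+oo] or to [0], so
    that [gumbel a n] approximates the indicator of [x < a]. *)
Lemma csub_lt V a : closed_subspace V ->
  (forall l, 0 < l -> V (emb (expo l))) -> V (emb (fun x => (x < a)%R%:R)).
Proof.
move=> hV Ve.
apply: (csub_dominated (g_ := gumbel a) (G := fun x => expR a * expo 1 x)) => //.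
- exact/sqRZ/sqR_expo.
- by move=> n; exact: measurable_gumbel.
- by case: (sqR_lt a).
- move=> n x x0; rewrite /gumbel /expo -expRD mul1r.
  set w := expR (a - x); have w0 : 0 < w by exact: expR_gt0.
  have wn0 : 0 <= w ^+ n.+1 by rewrite exprn_ge0// ltW.
  have e1 : expR (- w ^+ n.+1) <= 1 by rewrite -expR0 ler_expR oppr_le0.
  rewrite ger0_norm ?subr_ge0//; have [w1|w1] := leP w 1.
    have /andP[_ h] := expRN_bounds wn0; apply: le_trans h _.
    by rewrite exprS ler_piMr ?exprn_ile1// ltW.
  by apply: le_trans (ltW w1); rewrite lerBlDr lerDl expR_ge0.
- apply: (@filterS _ _ (ae_filter_ringOfSetsType mu) _ _ _ (ae_muRp_neq a)).
  move=> x /eqP xa; rewrite /gumbel.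
  have geo (q : R) : 0 < q < 1 -> (fun n => q ^+ n.+1) @ \oo --> 0.
    move=> /andP[q0 q1]; rewrite (cvg_shiftS (fun n => q ^+ n)).
    by apply: cvg_expr; rewrite gtr0_norm.
  case: ltgtP xa => // xa _.
    rewrite -[X in _ --> X]subr0; apply: cvgB; first exact: cvg_cst.
    apply: (@squeeze_cvgr _ _ _ _ (cst 0) (fun n => expR (x - a) ^+ n.+1)).
    + apply: nearW => n; rewrite expR_ge0/= expRN.
      rewrite -[leRHS]invrK lef_pV2 ?posrE ?expR_gt0 ?invr_gt0 ?exprn_gt0 ?expR_gt0//.
      rewrite -exprVn -expRN opprB.
      by apply: le_trans (expR_ge1Dx _); rewrite lerDr.
    + exact: cvg_cst.
    + by apply: geo; rewrite expR_gt0 expR_lt1 subr_lt0.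
  apply: (@squeeze_cvgr _ _ _ _ (cst 0) (fun n => expR (a - x) ^+ n.+1)).
  + apply: nearW => n.
    have wn0 : 0 <= expR (a - x) ^+ n.+1 by rewrite exprn_ge0// expR_ge0.
    have /andP[_ ->] := expRN_bounds wn0.
    by rewrite andbT subr_ge0 -expR0 ler_expR oppr_le0.
  + exact: cvg_cst.
  + by apply: geo; rewrite expR_gt0 expR_lt1 subr_lt0.
- by move=> n; exact: csub_gumbel.
Qed.

Lemma indic01 (A : set T) x : 0 <= (\1_A x : R) <= 1.
Proof. by rewrite indicE; case: (_ \in _); rewrite ?lexx ?ler01. Qed.

(** Half-lines generate the Borel sets and are stable under intersection, and
    the sets whose truncated indicator lies in [V] form a Dynkin class. *)
Lemma csub_indic V : closed_subspace V ->
  (forall a, V (emb (fun x => (x < a)%R%:R))) ->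
  forall (A : set T) a, measurable A -> V (emb (fun x => \1_A x * (x < a)%R%:R)).
Proof.
move=> hV Vlt A a mA.
have mi (B : set T) : measurable B -> measurable_fun setT (\1_B : T -> R).
  by move=> mB; exact: measurable_indic.
pose P := [set B : set T | V (emb (fun x => \1_B x * (x < a)%R%:R))].
have := @dynkin_induction _ T (@RGenInftyO.G R) P; apply.
- exact: RGenInftyO.measurableE.
- move=> _ _ [x ->] [y ->]; exists (Num.min x y).
  apply/seteqP; split => z /=; rewrite !in_itv/= lt_min; first by move=> [-> ->].
  by move=> /andP[].
- rewrite /P/=; rewrite (_ : (fun _ => _) = (fun x => (x < a)%R%:R)); first exact: Vlt.
  by apply/funext => x; rewrite indicT mul1r.
- move=> _ [y ->]; rewrite /P/=.
  rewrite (_ : (fun _ => _) = (fun x => (x < Num.min y a)%R%:R)); first exact: Vlt.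
  apply/funext => x; rewrite indicE lt_min mem_setE in_itv/=.
  by case: ltP => _ /=; rewrite ?mul1r ?mul0r.
- move=> S mS VS; rewrite /P/=.
  rewrite (_ : (fun _ => _) =
    (fun x => (x < a)%R%:R - \1_S x * (x < a)%R%:R)).
    rewrite embB; [|exact: sqR_lt|apply: sqR_cut => [|x]]; last 2 first.
      exact: mi.
      exact: indic01.
    exact: csubB.
  apply/funext => x; rewrite !indicE in_setC; case: (_ \in _) => /=;
    by rewrite ?mul0r ?mul1r ?subrr ?subr0.
- move=> F mF tF VF.
  pose s n x : R := \sum_(k < n) \1_(F k) x * (x < a)%R%:R.
  have Vs n : sqR (s n) /\ V (emb (s n)).
    apply: csub_emb_sum => // k; last exact: VF.
    by apply: (@sqR_cut (\1_(F k) : T -> R) a) => [|x]; [exact: mi|exact: indic01].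
  have s1 n x : s n x = \1_(\bigcup_(k < n) F k) x * (x < a)%R%:R.
    rewrite /s -mulr_suml; congr (_ * _).
    rewrite indicE; case: (boolP (x \in _)).
      rewrite inE => -[k /= kn Fk]; rewrite (bigD1 (Ordinal kn))//=.
      rewrite indicE mem_set// big1 ?addr0// => i; rewrite -val_eqE/= => ik.
      rewrite indicE memNset// => Fi; move/eqP: ik; apply.
      by apply: tF => //; exists x.
    move=> /negP xF; rewrite big1// => k _; rewrite indicE memNset// => Fk.
    by apply: xF; rewrite inE; exists k => //=.
  have mU n : measurable (\bigcup_(k < n) F k) by exact: bigcup_measurable.
  apply: (csub_dominated (g_ := s) (G := fun x => (x < a)%R%:R)) => //.
  + exact: sqR_lt.
  + by move=> n; case: (Vs n) => -[].
  + have : measurable (\bigcup_k F k) by exact: bigcup_measurable.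
    by move=> /mi h; case: (@sqR_cut _ a h (indic01 _)).
  + move=> n x _; rewrite s1 normrM [X in _ * X]ger0_norm//.
    have /andP[h0 h1] := indic01 (\bigcup_(k < n) F k) x.
    by rewrite ger0_norm// ler_piMl.
  + apply: aeW => x; rewrite (_ : s ^~ x =
      (fun n => \1_(\bigcup_(k < n) F k) x * (x < a)%R%:R)); last first.
      by apply/funext => n; rewrite s1.
    apply: cvgM; last exact: cvg_cst.
    rewrite [X in _ --> X]indicE; case: (boolP (x \in _)).
      rewrite inE => -[k _ Fk]; apply: cvg_near_cst; exists k.+1 => // n /= kn.
      by rewrite indicE mem_set//; exists k.
    move=> /negP xF; apply: cvg_near_cst; apply: nearW => n.
    rewrite indicE memNset// => -[k _ Fk]; apply: xF.
    by rewrite inE; exists k.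
  + by move=> n; case: (Vs n).
- have e : @measurable _ T = <<s @RGenInftyO.G R >> := RGenInftyO.measurableE R.
  by rewrite -e.
Qed.

Lemma csub_ge0 V f : closed_subspace V ->
  (forall (A : set T) a, measurable A -> V (emb (fun x => \1_A x * (x < a)%R%:R))) ->
  sqR f -> (forall x, 0 <= f x) -> V (emb f).
Proof.
move=> hV VA hf f0.
have mf : measurable_fun setT (EFin \o f) by apply/measurable_EFinP; case: hf.
pose h n : {nnsfun T >-> R} := nnsfun_approx measurableT mf n.
have hle n x : h n x <= f x.
  rewrite -lee_fin /h nnsfun_approxE; apply: (@le_approx _ T R setT (EFin \o f)) => //.
  by move=> y _ /=; rewrite lee_fin.
have hc x : (fun n => h n x) @ \oo --> f x.
  have := @cvg_nnsfun_approx _ T R setT measurableT (EFin \o f) mf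
    (fun y _ => f0 y) x I.
  by move=> /fine_cvgP[].
pose g n x := h n x * (x < n%:R)%R%:R.
have Vg n : sqR (g n) /\ V (emb (g n)).
  have [r hr] : exists r : seq R,
      forall x, h n x = \sum_(y <- r) (y * \1_(h n @^-1` [set y]) x).
    by exists (finmap.enum_fset (fset_set (range (h n)))) => x; rewrite fimfunE fsbig_finite.
  have -> : g n = (fun x => \sum_(y <- r)
      y * (\1_(h n @^-1` [set y]) x * (x < n%:R)%R%:R)).
    by apply/funext => x; rewrite /g hr mulr_suml; apply: eq_bigr => y _; rewrite mulrA.
  have mS (y : R) : measurable (h n @^-1` [set y]).
    by rewrite -[X in measurable X]setTI; exact: measurable_funP.
  have sS (y : R) : sqR (fun x => \1_(h n @^-1` [set y]) x * (x < n%:R)%R%:R).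
    apply: (@sqR_cut (\1_(h n @^-1` [set y]) : T -> R)) => [|x].
      exact: measurable_indic.
    exact: indic01.
  apply: csub_emb_sum => // y; first exact: sqRZ.
  by rewrite embZ//; apply: csubZ => //; exact: VA.
apply: (csub_dominated (g_ := g) (G := f)) => //.
- by move=> n; case: (Vg n) => -[].
- by case: hf.
- move=> n x _; rewrite /g normrM !ger0_norm//.
  by apply: le_trans (hle n x); rewrite ler_piMr// lern1 leq_b1.
- apply: aeW => x; rewrite -[X in _ --> X]mulr1; apply: cvgM; first exact: hc.
  apply: cvg_near_cst; exists (Num.trunc `|x|).+1 => // n /= xn.
  rewrite (le_lt_trans (ler_norm x))// (lt_le_trans (truncnS_gt _))//.
  by rewrite ler_nat.
- by move=> n; case: (Vg n).
Qed.

(** From the exponents in one interval one reaches all positive exponents by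
    analyticity, then indicators of half-lines through double exponentials,
    then indicators of Borel sets, simple functions and all of [L2]. *)
Theorem expo_dense V a b : closed_subspace V -> 0 <= a -> a < b ->
  (forall l, a < l < b -> V (emb (expo l))) -> V = setT.
Proof.
move=> hV a0 ab Ve.
have Vp f : sqR f -> (forall x, 0 <= f x) -> V (emb f).
  move=> hf f0; apply: csub_ge0 => //; apply: csub_indic => // c.
  by apply: csub_lt => //; exact: (csub_expo_all hV a0 ab Ve).
have Vr f : sqR f -> V (emb f).
  move=> hf; have [mf If] := hf.
  have hn := sqR_normr hf.
  have -> : f = (fun x => `|f x| - (`|f x| - f x)).
    by apply/funext => x; rewrite opprB addrC subrK.
  have hnf : sqR (fun x => `|f x| - f x) by exact: sqRB.
  rewrite embB//; apply: csubB => //; first by apply: Vp.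
  by apply: Vp => // x; rewrite subr_ge0 ler_norm.
apply/seteqP; split => // u _.
have hu := valP (L2repr u).
have hR := (sqR_emb _).1 (sqR_Re hu); have hI := (sqR_emb _).1 (sqR_Im hu).
rewrite -[u]L2of_repr.
have -> : L2of (L2repr u) = emb (@complex.Re R \o L2repr u)
    + 'i%C *: emb (@complex.Im R \o L2repr u).
  rewrite /emb -L2ofZ// -L2ofD//; last exact: (rpredZ ('i%C) hI).
  congr L2of; apply/funext => x /=; case: (sqfun_val _ _) => p q; simpc.
  by [].
apply: csubD => //; first exact/Vr/sqR_Re.
by apply: csubZ => //; exact/Vr/sqR_Im.
Qed.

End density.

(** * Integrals on the half-line and on the line *)

Section lebesgue_on_the_line.
Set Implicit Arguments.
Unset Strict Implicit.
Unset Printing Implicit Defensive.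
Context {R : realType}.
Local Notation mu := (muRp R).
Local Notation leb := (@lebesgue_measure R).
Local Notation T := (measurableTypeR R).
Implicit Types (f g : T -> \bar R).

Lemma muRp_le_leb (A : set T) : measurable A -> (mu A <= leb A)%E.
Proof.
move=> mA; rewrite /muRp/= /mrestr.
by apply: le_measure; rewrite ?inE//; exact: measurableI.
Qed.

Lemma ge0_integral_muRp_le g : measurable_fun setT g -> (forall x, 0 <= g x)%E ->
  (\int[mu]_x g x <= \int[leb]_x g x)%E.
Proof. by move=> mg g0; apply: ge0_le_measure_integral => //; exact: muRp_le_leb. Qed.

Lemma integral_muRp g : measurable_fun setT g ->
  (forall x, x < 0 -> g x = 0%E) -> (\int[mu]_x g x = \int[leb]_x g x)%E.
Proof.
have main f : measurable_fun setT f -> (forall x, 0 <= f x)%E ->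
    (forall x, x < 0 -> f x = 0%E) -> (\int[mu]_x f x = \int[leb]_x f x)%E.
  move=> mf f0 fN; pose D := `[0%R, +oo[%classic : set T.
  have mD : measurable D by exact: measurable_itv.
  pose mu' := mrestr leb (measurableC mD).
  rewrite [RHS](@eq_measure_integral _ _ _ _ (measure_add mu mu')); last first.
    move=> A mA _; rewrite [RHS](measure_addE mu mu') /mu' /muRp/= /mrestr.
    by rewrite addeC -setDE; exact: measureDI.
  rewrite ge0_integral_measure_add// (_ : (\int[mu']_x f x = 0)%E) ?adde0//.
  rewrite (ae_eq_integral (cst 0%E))// ?integral0//.
  exists D; split => //; first by rewrite /mu'/= /mrestr setICr measure0.
  move=> x /= nf; rewrite /D/= in_itv/= andbT leNgt; apply/negP => x0.
  by apply: nf => _; rewrite fN.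
move=> mg gN; rewrite integralE [RHS]integralE; congr (_ - _)%E; apply: main => //.
- exact: measurable_funepos.
- by move=> x x0; rewrite funeposE gN// maxxx.
- exact: measurable_funeneg.
- by move=> x x0; rewrite funenegE gN// oppe0 maxxx.
Qed.

Lemma integral_shift g t : measurable_fun setT g ->
  (\int[leb]_x g (x + t)%R = \int[leb]_x g x)%E.
Proof.
have mt : measurable_fun setT (fun x : T => (x + t)%R : T).
  exact: measurable_funD.
have main f : measurable_fun setT f -> (forall x, 0 <= f x)%E ->
    (\int[leb]_x f (x + t)%R = \int[leb]_x f x)%E.
  move=> mf f0.
  rewrite [RHS](@eq_measure_integral _ _ _ _ (pushforward leb
    (fun x : T => (x + t)%R : T))); last first.
    by move=> A mA _; apply/esym; exact: lebesgue_measure_translate.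
  by rewrite ge0_integral_pushforward.
move=> mg; rewrite integralE [RHS]integralE; congr (_ - _)%E.
  rewrite -[RHS](main _ (measurable_funepos mg))//.
  by apply: eq_integral => x _; rewrite !funeposE.
rewrite -[RHS](main _ (measurable_funeneg mg))//.
by apply: eq_integral => x _; rewrite !funenegE.
Qed.

Lemma ge0_integral_opp g : measurable_fun setT g -> (forall x, 0 <= g x)%E ->
  (\int[leb]_x g (- x)%R = \int[leb]_x g x)%E.
Proof.
move=> mg g0.
have mN : measurable_fun setT (fun x : T => (- x)%R : T).
  exact: measurable_funN.
rewrite [RHS](@eq_measure_integral _ _ _ _ (pushforward leb
  (fun x : T => (- x)%R : T))); last first.
  move=> A mA _; apply: (@lebesgue_measure_unique R (pushforward leb
    (fun x : T => - x : T))) => //= _ [[x y]] _ <-.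
  rewrite /pushforward/=.
  have -> : (fun z : R => - z) @^-1` `]x, y] = `[- y, - x[%classic.
    by apply/seteqP; split=> z /=; rewrite !in_itv/= lerNl ltrNr => /andP[-> ->].
  rewrite !lebesgue_measure_itv/= !lte_fin ltrN2 -!EFinB.
  by rewrite opprK addrC.
by rewrite ge0_integral_pushforward.
Qed.

End lebesgue_on_the_line.

Section convolution.
Set Implicit Arguments.
Unset Strict Implicit.
Unset Printing Implicit Defensive.
Context {R : realType}.
Local Notation mu := (muRp R).
Local Notation leb := (@lebesgue_measure R).
Local Notation T := (measurableTypeR R).
Implicit Types (p k r h : T -> R) (l c : R).

(** Fubini's theorem, after the substitution [u = x + t] in the integral over
    [t]. *)
Lemma integral_correlation p k :
  leb.-integrable setT (EFin \o p) -> leb.-integrable setT (EFin \o k) ->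
  leb.-integrable setT (fun t => \int[leb]_x (p x * k (x + t))%:E)%E /\
  (\int[leb]_t \int[leb]_x (p x * k (x + t))%:E =
   \int[leb]_x (p x)%:E * \int[leb]_x (k x)%:E)%E.
Proof.
move=> ip ik.
have mp : measurable_fun setT p by apply/measurable_EFinP; exact: measurable_int ip.
have mk : measurable_fun setT k by apply/measurable_EFinP; exact: measurable_int ik.
pose F (z : T * T) : \bar R := (p z.2 * k (z.2 + z.1))%:E.
have mF : measurable_fun setT F.
  apply/measurable_EFinP; apply: measurable_funM.
    exact: (measurableT_comp mp measurable_snd).
  apply: (measurableT_comp mk); apply: measurable_funD.
    exact: measurable_snd.
  exact: measurable_fst.
have inner (x : R) : (\int[leb]_t (p x * k (x + t))%:E =
    (p x)%:E * \int[leb]_t (k t)%:E)%E.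
  under eq_integral do rewrite EFinM addrC.
  rewrite integralZl//.
    congr (_ * _)%E; rewrite -(integral_shift x (g := EFin \o k))//.
    exact/measurable_EFinP.
  apply/integrableP; split.
    apply/measurable_EFinP; apply: (measurableT_comp mk).
    exact: measurable_funD.
  rewrite (integral_shift x (g := fun x => `|(k x)%:E|%E)).
    by case/integrableP: ik.
  by apply/measurable_EFinP; exact: measurableT_comp.
have iF : (leb \x leb)%E.-integrable setT F.
  apply/integrable21ltyP => //.
  have innerA (x : R) : (\int[leb]_t `|F (t, x)| =
      `|p x|%:E * \int[leb]_t `|(k t)%:E|)%E.
    rewrite /F/=; under eq_integral do rewrite normrM EFinM addrC.
    rewrite ge0_integralZl//.
      congr (_ * _)%E; rewrite -(integral_shift x (g := fun x => `|(k x)%:E|%E))//.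
      by apply/measurable_EFinP; exact: measurableT_comp.
    apply/measurable_EFinP; apply: measurableT_comp => //.
    by apply: (measurableT_comp mk); exact: measurable_funD.
  under eq_integral do rewrite innerA.
  have /integrableP[_ kfin] := ik; have /integrableP[_ pfin] := ip.
  rewrite ge0_integralZr//.
    by rewrite lte_mul_pinfty ?integral_ge0// ge0_fin_numE ?integral_ge0.
  apply/measurable_EFinP; exact: measurableT_comp.
  exact: integral_ge0.
split; first exact: (integrable_fubini_F iF).
rewrite (Fubini iF) /=; under eq_integral do rewrite inner.
rewrite -(fineK (integrable_fin_num measurableT ik)).
by rewrite integralZr.
Qed.

Lemma integrable_muRp_leb (g : T -> R) : mu.-integrable setT (EFin \o g) ->
  (forall x, x < 0 -> g x = 0) ->
  leb.-integrable setT (EFin \o g) /\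
  (\int[leb]_x (g x)%:E = (\int[mu]_x g x)%:E)%E.
Proof.
move=> ig gN; have /integrableP[mg fin] := ig; split.
  apply/integrableP; split => //; rewrite -integral_muRp//.
    exact: measurableT_comp.
  by move=> x x0; rewrite /= gN// normr0.
rewrite -integral_muRp//; last by move=> x x0; rewrite gN.
by rewrite /Rintegral fineK//; exact: integrable_fin_num.
Qed.

Lemma expo_tail_integrable l c : 0 < l ->
  (\int[leb]_t (expR (l * t) * (t <= c)%R%:R)%:E < +oo)%E.
Proof.
move=> l0; pose w t : \bar R := (expR (l * t) * (t <= c)%R%:R)%:E.
have w0 t : (0 <= w t)%E by rewrite lee_fin mulr_ge0 ?expR_ge0.
have mw : measurable_fun setT w.
  apply/measurable_EFinP; apply: measurable_funM.
    by apply: measurableT_comp => //; exact: measurable_funM.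
  exact: measurable_le_indic.
have mwN : measurable_fun setT (fun t : T => w (- t)).
  by apply: (measurableT_comp mw); exact: measurable_funN.
(* the substitution [t = c - x] turns the tail into a decaying exponential *)
rewrite -(ge0_integral_opp mw w0) -(integral_shift (- c) mwN).
have -> : (fun x => w (- (x - c))) =
    (fun x => ((expR (l * c) * (0 <= x)%R%:R) * expo (l / 2) x ^+ 2)%:E).
  apply/funext => x; rewrite /w opprB lerBlDr lerDl; congr EFin.
  rewrite mulrAC; congr (_ * _); rewrite /expo -expRM_natl -expRD.
  by congr expR; field.
have m0 := @measurable_ge0_indic R.
have me : measurable_fun setT (fun x : T => expo (l / 2) x ^+ 2).
  by apply: measurable_funX; exact: measurable_expo.
rewrite -integral_muRp; last 2 first.
- by apply/measurable_EFinP; apply: measurable_funM => //; exact: measurable_funM.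
- by move=> x x0; rewrite leNgt x0 mulr0 mul0r.
apply: (@le_lt_trans _ _
    (\int[mu]_x ((expR (l * c))%:E * (expo (l / 2) x ^+ 2)%:E))%E).
  apply: ge0_le_integral => //.
  - by move=> x _; rewrite lee_fin !mulr_ge0 ?expR_ge0 ?sqr_ge0.
  - by apply/measurable_EFinP; apply: measurable_funM => //; exact: measurable_funM.
  - by apply/measurable_EFinP; exact: measurable_funM.
  - move=> x _; rewrite -EFinM lee_fin ler_wpM2r ?sqr_ge0//.
    by rewrite ler_piMr ?expR_ge0// lern1 leq_b1.
rewrite ge0_integralZl//; first last.
- by move=> x _; rewrite lee_fin sqr_ge0.
- exact/measurable_EFinP.
rewrite lte_mul_pinfty ?lee_fin ?expR_ge0//.
by have [_] := @sqR_expo R (l / 2) (divr_gt0 l0 (ltr0n _ 2)).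
Qed.

End convolution.

(** * Correlations and Laplace transforms *)

Section translates.
Set Implicit Arguments.
Unset Strict Implicit.
Unset Printing Implicit Defensive.
Context {R : realType}.
Local Notation C := R[i].
Local Notation mu := (muRp R).
Local Notation leb := (@lebesgue_measure R).
Local Notation T := (measurableTypeR R).
Implicit Types (r h : T -> R) (F : T -> C) (l c t x : R).

Lemma ge0_shift_le (g : T -> \bar R) t : measurable_fun setT g ->
  (forall x, 0 <= g x)%E -> (forall x, x < 0 -> g x = 0%E) ->
  (\int[mu]_x g (x + t)%R <= \int[mu]_x g x)%E.
Proof.
move=> mg g0 gN; rewrite [leRHS]integral_muRp// -(integral_shift t mg).
apply: (ge0_integral_muRp_le (g := fun x => g (x + t))) => //.
by apply: (measurableT_comp mg); exact: measurable_funD.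
Qed.

Lemma sqR_shift h t : sqR h -> (forall x, x < 0 -> h x = 0) ->
  sqR (fun x => h (x + t)).
Proof.
move=> [mh Ih] hN; split.
  by apply: (measurableT_comp mh); exact: measurable_funD.
apply: le_lt_trans Ih; apply: (ge0_shift_le (g := fun x => (h x ^+ 2)%:E)).
- by apply/measurable_EFinP; exact: measurable_funX.
- by move=> x; rewrite lee_fin sqr_ge0.
- by move=> x x0; rewrite hN// expr0n.
Qed.

Lemma shift_sq F t : F \in @sq_integrable R -> (forall x, x < 0 -> F x = 0) ->
  (fun x => F (x + t)) \in @sq_integrable R.
Proof.
move=> /sq_integrable_sqR[hR hI] FN; apply/sq_integrable_sqR; split.
  by apply: (sqR_shift t hR) => x x0 /=; rewrite FN.
by apply: (sqR_shift t hI) => x x0 /=; rewrite FN.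
Qed.

Lemma rnorm_shift_le F t : F \in @sq_integrable R -> (forall x, x < 0 -> F x = 0) ->
  rnorm (L2of (fun x => F (x + t))) <= rnorm (L2of F).
Proof.
move=> hF FN; rewrite -ler_sqr ?nnegrE ?rnorm_ge0// -lee_fin.
rewrite !rnorm_sqE//; last exact: shift_sq.
apply: (ge0_shift_le (g := fun x => (csq (F x))%:E)).
- by apply: emeasurable_csq; case/sq_integrableE: hF.
- by move=> x; rewrite lee_fin csq_ge0.
- by move=> x x0; rewrite FN// /csq/= expr0n addr0.
Qed.

Lemma measurable_expRM l : measurable_fun setT (fun x : T => expR (l * x)).
Proof. by apply: measurableT_comp => //; exact: measurable_funM. Qed.

Lemma sqR_expR_window l c : sqR (fun x => expR (l * x) * (x <= c)%R%:R).
Proof.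
apply: (@sqR_le _ _ (fun x => expR (`|l| * `|c|) * (expR `|c| * expo 1 x))).
- by apply: measurable_funM; [exact: measurable_expRM|exact: measurable_le_indic].
- by apply/sqRZ/sqRZ/sqR_expo.
- move=> x x0; rewrite normrM (gtr0_norm (expR_gt0 _)).
  case: (leP x c) => xc /=; last by rewrite normr0 mulr0 !mulr_ge0 ?expR_ge0.
  have xc' : x <= `|c| by rewrite (le_trans xc)// ler_norm.
  rewrite normr1 mulr1 /expo -!expRD ler_expR mul1r.
  apply: le_trans (_ : _ <= `|l| * `|c|) _; last by rewrite lerDl subr_ge0.
  apply: le_trans (ler_norm _) _; rewrite normrM ler_wpM2l// ger0_norm//.
Qed.

(** The exponent is [+ l]: this is the Laplace transform at [- l], which exists
    for every [l] as soon as [h] vanishes far to the right. *)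
Definition laplace h l := \int[mu]_x (h x * expR (l * x)).

Lemma integrable_laplace h l c : sqR h -> (forall x, c < x -> h x = 0) ->
  mu.-integrable setT (EFin \o (fun x => h x * expR (l * x))).
Proof.
move=> hh hc; have := integrable_mul hh (sqR_expR_window l c).
rewrite (_ : h \* _ = (fun x => h x * expR (l * x)))//.
apply/funext => x /=; case: (leP x c) => xc /=; first by rewrite mulr1.
by rewrite hc// !mul0r.
Qed.

(** Since [expR (l * t) = expo l x * expR (l * (x + t))], integrating the
    correlation of [r] and [h] against an exponential separates the two
    functions. The correlation is carried by [t <= c], so that the growing
    exponential is harmless. *)
Lemma correlation_laplace r h l c : 0 < l -> sqR r -> sqR h ->
  (forall x, x < 0 -> h x = 0) -> (forall x, c < x -> h x = 0) ->
  leb.-integrable setT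
    (EFin \o (fun t => expR (l * t) * \int[mu]_x (r x * h (x + t)))) /\
  (\int[leb]_t (expR (l * t) * \int[mu]_x (r x * h (x + t)))%:E =
   ((\int[mu]_x (r x * expo l x)) * laplace h l)%:E)%E.
Proof.
move=> l0 hr hh hN hc.
pose p x := r x * (expo l x * (0 <= x)%R%:R).
pose k x := h x * expR (l * x).
have se : sqR (fun x => expo l x * (0 <= x)%R%:R).
  apply: (@sqR_le _ _ (expo l)); [|exact: sqR_expo|].
    by apply: measurable_funM; [exact: measurable_expo|exact: measurable_ge0_indic].
  move=> x x0; rewrite x0 mulr1 ger0_norm// expR_ge0//.
have ip := integrable_mul hr se.
have ik := integrable_laplace l hh hc.
have [ipl pE] := integrable_muRp_leb ip (fun x (x0 : x < 0) => ltac:(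
  by rewrite /= leNgt x0 !mulr0)).
have [ikl kE] := integrable_muRp_leb ik (fun x (x0 : x < 0) => ltac:(
  by rewrite /= hN// mul0r)).
have B t : (\int[leb]_x (p x * k (x + t))%:E =
    (expR (l * t) * \int[mu]_x (r x * h (x + t)))%:E)%E.
  have irh := integrable_mul hr (sqR_shift t hh hN).
  rewrite -RintegralZl//.
  have irh' : mu.-integrable setT
      (EFin \o (fun x => expR (l * t) * (r x * h (x + t)))).
    exact: (integrableZl measurableT (expR (l * t)) irh).
  rewrite -integral_muRp; last 2 first.
  - apply/measurable_EFinP; apply: measurable_funM.
      by apply/measurable_EFinP; exact: measurable_int ip.
    have mk : measurable_fun setT k.
      by apply/measurable_EFinP; exact: measurable_int ik.
    by apply: (measurableT_comp mk); exact: measurable_funD.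
  - by move=> x x0; rewrite /p leNgt x0 !mulr0 mul0r.
  rewrite /Rintegral fineK; last exact: integrable_fin_num.
  apply: ae_eq_integral => //.
  - apply/measurable_EFinP; apply: measurable_funM.
      by apply/measurable_EFinP; exact: measurable_int ip.
    have mk : measurable_fun setT k.
      by apply/measurable_EFinP; exact: measurable_int ik.
    by apply: (measurableT_comp mk); exact: measurable_funD.
  - exact: measurable_int irh'.
  - apply: muRp_ae_ge0 => x x0 _; congr EFin; rewrite /p /k x0 mulr1.
    have -> : expR (l * (x + t)) = expR (l * x) * expR (l * t).
      by rewrite mulrDr expRD.
    rewrite /expo expRN; field.
    by rewrite gt_eqF// expR_gt0.
have [h1 h2] := integral_correlation ipl ikl.
have E : (fun t => \int[leb]_x (p x * k (x + t))%:E)%E =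
    (EFin \o (fun t => expR (l * t) * \int[mu]_x (r x * h (x + t)))).
  by apply/funext => t; rewrite B.
split; first by rewrite -E.
under eq_integral do rewrite -B.
rewrite h2 pE kE -EFinM; congr ((_ * _)%:E).
apply: Rintegral_ae => //; first exact: integrable_mul hr (sqR_expo l0).
by apply: muRp_ae_ge0 => x x0 /=; rewrite x0 mulr1.
Qed.

(** A function nearly orthogonal to all translates of [h] has a small product
    of its Laplace transform with that of [h]. Two summands are needed because
    the real part of a product of complex functions has two. *)
Lemma correlation_bound r1 r2 h1 h2 l c (K : R) : 0 < l ->
  sqR r1 -> sqR r2 -> sqR h1 -> sqR h2 ->
  (forall x, x < 0 -> h1 x = 0) -> (forall x, c < x -> h1 x = 0) ->
  (forall x, x < 0 -> h2 x = 0) -> (forall x, c < x -> h2 x = 0) ->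
  (forall t, `|\int[mu]_x (r1 x * h1 (x + t))
             + \int[mu]_x (r2 x * h2 (x + t))| <= K) ->
  `|(\int[mu]_x (r1 x * expo l x)) * laplace h1 l
    + (\int[mu]_x (r2 x * expo l x)) * laplace h2 l|
  <= K * fine (\int[leb]_t (expR (l * t) * (t <= c)%R%:R)%:E).
Proof.
move=> l0 sr1 sr2 sh1 sh2 h1N h1c h2N h2c hK.
have [i1 e1] := correlation_laplace l0 sr1 sh1 h1N h1c.
have [i2 e2] := correlation_laplace l0 sr2 sh2 h2N h2c.
have wfin := @expo_tail_integrable R l c l0.
have w0 t : (0 <= (expR (l * t) * (t <= c)%R%:R)%:E)%E.
  by rewrite lee_fin mulr_ge0// expR_ge0.
have mw : measurable_fun setT (fun t : T => expR (l * t) * (t <= c)%R%:R : R).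
  by apply: measurable_funM; [exact: measurable_expRM|exact: measurable_le_indic].
have K0 : 0 <= K by exact: le_trans (hK 0).
rewrite -lee_fin EFinM fineK; last by rewrite ge0_fin_numE// integral_ge0.
rewrite -abse_EFin EFinD -e1 -e2 -integralD//.
apply: le_trans (le_abse_integral _ _ _) _ => //.
  by apply: measurable_int; exact: (integrableD measurableT i1 i2).
rewrite -ge0_integralZl//; last exact/measurable_EFinP.
apply: ge0_le_integral => //.
- apply: measurableT_comp => //; apply: measurable_int.
  exact: (integrableD measurableT i1 i2).
- by apply/measurable_EFinP; exact: measurable_funM.
- move=> t _; rewrite -EFinD abse_EFin -EFinM lee_fin -mulrDr normrM.
  rewrite (gtr0_norm (expR_gt0 _)) mulrCA ler_pM2l ?expR_gt0//.
  case: (leP t c) => tc /=; first by rewrite mulr1; exact: hK.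
  have z (r h : T -> R) : sqR r -> sqR h -> (forall x, x < 0 -> h x = 0) ->
      (forall x, c < x -> h x = 0) -> \int[mu]_x (r x * h (x + t)) = 0.
    move=> sr sh hN hc; rewrite (@Rintegral_ae _ _ (fun=> 0)).
    + by rewrite /Rintegral integral0.
    + exact: integrable_mul sr (sqR_shift t sh hN).
    + exact: integrable0.
    + apply: muRp_ae_ge0 => x x0; rewrite hc ?mulr0//.
      by rewrite (lt_le_trans tc)// lerDr.
  by rewrite !z// addr0 normr0 mulr0.
Qed.

Lemma continuous_laplace h c l : sqR h -> (forall x, c < x -> h x = 0) ->
  {for l, continuous (laplace h)}.
Proof.
move=> hh hc; pose B := `|l| + 1.
have := @continuity_under_integral R _ T mu (fun l x => h x * expR (l * x))
  setT measurableT (l - 1) (l + 1) _ _ (fun x => `|h x * expR (B * x)|).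
apply.
- by move=> x _; exact: integrable_laplace hh hc.
- apply: aeW => x _ m _; apply: cvgM; first exact: cvg_cst.
  apply: continuous_comp; last exact: continuous_expR.
  by apply: cvgM; [exact: cvg_id|exact: cvg_cst].
- have := integrable_abse (integrable_laplace B hh hc).
  by [].
- move=> m /=; rewrite in_itv/= => /andP[m1 m2].
  apply: muRp_ae_ge0 => x x0 _; rewrite !normrM ler_wpM2l//.
  rewrite !gtr0_norm ?expR_gt0// ler_expR ler_wpM2r//.
  by have := ler_norm l; rewrite /B; lra.
- by rewrite inE/= in_itv/=; apply/andP; split; lra.
Qed.

End translates.

(** * Translates of a compactly supported function *)

Section span_of_translates.
Set Implicit Arguments.
Unset Strict Implicit.
Unset Printing Implicit Defensive.
Context {R : realType}.
Local Notation C := R[i].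
Local Notation mu := (muRp R).
Local Notation T := (measurableTypeR R).
Implicit Types (F : T -> C) (V : set (L2 R)) (c t x l m : R).

Lemma L2of0 : L2of (fun=> 0) = 0 :> L2 R.
Proof.
have h0 : (fun=> 0) \in @sq_integrable R by exact: (rpred0 (@sq_integrable R)).
by apply: rnorm_eq0; apply/eqP; rewrite -sqrf_eq0 -eqe rnorm_sqE//
  (_ : (fun _ => _) = cst 0%E) ?integral0//; apply/funext => x;
  rewrite /csq/= expr0n addr0.
Qed.

Lemma L2of_eq0 F : F \in @sq_integrable R ->
  L2of F = 0 <-> {ae mu, forall x, F x = 0}.
Proof.
move=> hF; have h0 : (fun=> 0) \in @sq_integrable R.
  exact: (rpred0 (@sq_integrable R)).
split=> [|F0]; last by rewrite -L2of0; exact: L2of_eq.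
rewrite -L2of0 !L2ofE => /eqP; rewrite L2class_eq => /ae_nullP.
by apply: (@filterS _ _ (ae_filter_ringOfSetsType mu)) => x /= <-; rewrite subr0.
Qed.

Lemma Rintegral_eq0 (g : T -> R) : (forall x, g x = 0) -> \int[mu]_x g x = 0.
Proof. by move=> g0; rewrite /Rintegral integral0_eq// => x _; rewrite g0. Qed.

Lemma ip_emb F (g : T -> R) : F \in @sq_integrable R -> sqR g ->
  ip (L2of F) (emb g) = \int[mu]_x (complex.Re (F x) * g x).
Proof.
move=> hF /sqR_emb hg; rewrite ip_L2of// /ipf /=.
rewrite [X in _ + X](_ : _ = 0) ?addr0//.
by apply: Rintegral_eq0 => x; rewrite mulr0.
Qed.

Lemma ip_iemb F (g : T -> R) : F \in @sq_integrable R -> sqR g ->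
  ip (L2of F) ('i%C *: emb g) = \int[mu]_x (complex.Im (F x) * g x).
Proof.
move=> hF /sqR_emb hg; rewrite -L2ofZ// ip_L2of//; last exact: (rpredZ 'i%C hg).
rewrite /ipf [X in X + _](_ : _ = 0) ?add0r.
  by apply: eq_Rintegral => x _; simpc.
by apply: Rintegral_eq0 => x /=; rewrite mul0r mulr0 subrr mulr0.
Qed.

(** Otherwise the square integrable function [F x * expR x] would be orthogonal
    to [expo l] for every [l] between [0] and [1], hence to everything by
    [expo_dense]. The factor [expR x] makes up for the sign of the exponent in
    [laplace]. *)
Lemma laplace_neq0 F c : F \in @sq_integrable R ->
  (forall x, c < x -> F x = 0) -> L2of F != 0 ->
  exists2 l, 0 < l < 1 &
    (laplace (@complex.Re R \o F) l != 0) || (laplace (@complex.Im R \o F) l != 0).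
Proof.
move=> hF Fc F0; apply: contrapT => hn.
have L0 l : 0 < l < 1 ->
    laplace (@complex.Re R \o F) l = 0 /\ laplace (@complex.Im R \o F) l = 0.
  move=> l01; have : ~~ ((laplace (@complex.Re R \o F) l != 0)
    || (laplace (@complex.Im R \o F) l != 0)).
    by apply/negP => h; apply: hn; exists l.
  by rewrite negb_or !negbK => /andP[/eqP -> /eqP ->].
pose w x : R := expR (1 * x) * (x <= c)%R%:R.
have sw : sqR w by exact: sqR_expR_window.
have wb x : 0 <= x -> `|w x| <= expR `|c|.
  move=> x0; rewrite /w mul1r normrM (gtr0_norm (expR_gt0 _)).
  case: (leP x c) => xc /=; last by rewrite normr0 mulr0 expR_ge0.
  by rewrite normr1 mulr1 ler_expR (le_trans xc)// ler_norm.
pose G x : C := F x * (w x)%:C%C.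
have sG (h : T -> R) : sqR h -> sqR (fun x => h x * w x).
  move=> sh; apply: (@sqR_le _ _ (fun x => expR `|c| * `|h x|)).
  - by apply: measurable_funM; [case: sh|case: sw].
  - exact/sqRZ/sqR_normr.
  - by move=> x x0; rewrite normrM mulrC ler_wpM2r// wb.
have [sR sI] := (sq_integrable_sqR F).1 hF.
have GR x : complex.Re (G x) = complex.Re (F x) * w x.
  by rewrite /G; case: (F x) => p q; simpc.
have GI x : complex.Im (G x) = complex.Im (F x) * w x.
  by rewrite /G; case: (F x) => p q; simpc.
have hG : G \in @sq_integrable R.
  apply/sq_integrable_sqR; split.
    rewrite (_ : _ \o _ = (fun x => complex.Re (F x) * w x)); first exact: sG sR.
    by apply/funext => x; rewrite /= GR.
  rewrite (_ : _ \o _ = (fun x => complex.Im (F x) * w x)); first exact: sG sI.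
  by apply/funext => x; rewrite /= GI.
have E (p : C -> R) l : p 0 = 0 -> \int[mu]_x (p (F x) * w x * expo l x) =
    laplace (p \o F) (1 - l).
  move=> p0; apply: eq_Rintegral => x _; rewrite /w/=.
  case: (leP x c) => xc /=; last by rewrite Fc// p0 !mul0r.
  by rewrite mulr1 -mulrA /expo -expRD; congr (_ * expR _); ring.
have ER l : \int[mu]_x (complex.Re (G x) * expo l x)
    = laplace (@complex.Re R \o F) (1 - l).
  by rewrite -E//; apply: eq_Rintegral => x _; rewrite GR.
have EI l : \int[mu]_x (complex.Im (G x) * expo l x)
    = laplace (@complex.Im R \o F) (1 - l).
  by rewrite -E//; apply: eq_Rintegral => x _; rewrite GI.
pose V := [set u | ip (L2of G) u = 0 /\ ip (L2of G) ('i%C *: u) = 0].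
have hV : closed_subspace V by exact: closed_subspace_annihilator.
have VT : V = setT.
  apply: (expo_dense hV (lexx 0) ltr01) => l /andP[l0 l1].
  have l01 : 0 < 1 - l < 1 by rewrite subr_gt0 l1 ltrBlDr ltrDl l0.
  have [LR LI] := L0 (1 - l) l01; have sl := sqR_expo l0; split.
    by rewrite (ip_emb hG sl) ER LR.
  by rewrite (ip_iemb hG sl) EI LI.
have [ipG _] : V (L2of G) by rewrite VT.
have : L2of G = 0.
  by apply: rnorm_eq0; apply/eqP; rewrite -sqrf_eq0 -ipuu ipG.
move=> /(L2of_eq0 hG) aG; move/eqP: F0; apply; apply/(L2of_eq0 hF).
apply: (@filterS _ _ (ae_filter_ringOfSetsType mu) _ _ _ aG) => x.
rewrite /G /w; case: (leP x c) => xc /=; last by rewrite Fc.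
rewrite mulr1 => /eqP; rewrite mulf_eq0 => /orP[/eqP //|].
by move=> /eqP [] /eqP; rewrite expR_eq0.
Qed.

(** A weak form of Titchmarsh's theorem. If [r] is nearly orthogonal to all
    translates of [F], then by [correlation_bound] the product of the Laplace
    transforms of [r] and [F] is small, and where that of [F] is not zero this
    makes [r] nearly orthogonal to the exponential; by [csub_weak] the
    exponential belongs to [V]. This holds on an interval of exponents, and
    [expo_dense] concludes. *)
Theorem translates_total V F c : closed_subspace V -> F \in @sq_integrable R ->
  (forall x, x < 0 -> F x = 0) -> (forall x, c < x -> F x = 0) ->
  L2of F != 0 -> (forall t, V (L2of (fun x => F (x + t)))) -> V = setT.
Proof.
move=> hV hF FN Fc F0 VF.
pose hR : T -> R := @complex.Re R \o F; pose hI : T -> R := @complex.Im R \o F.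
have [sR sI] : sqR hR /\ sqR hI by exact/sq_integrable_sqR.
have hRN x : x < 0 -> hR x = 0 by move=> x0; rewrite /hR/= FN.
have hIN x : x < 0 -> hI x = 0 by move=> x0; rewrite /hI/= FN.
have hRc x : c < x -> hR x = 0 by move=> x0; rewrite /hR/= Fc.
have hIc x : c < x -> hI x = 0 by move=> x0; rewrite /hI/= Fc.
pose D l := laplace hR l ^+ 2 + laplace hI l ^+ 2.
have [l /andP[l0 l1] ln0] := laplace_neq0 hF Fc F0.
have Dl : 0 < D l.
  rewrite lt_def addr_ge0 ?sqr_ge0// andbT paddr_eq0 ?sqr_ge0// !sqrf_eq0.
  by rewrite negb_and.
have cD : {for l, continuous D}.
  have cR := @continuous_laplace _ hR c l sR hRc.
  have cI := @continuous_laplace _ hI c l sI hIc.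
  rewrite (_ : D = (fun l => laplace hR l * laplace hR l
    + laplace hI l * laplace hI l)).
    by apply: cvgD; apply: cvgM.
  by apply/funext.
have [e e0 eD] : exists2 e : R, 0 < e & forall m, `|l - m| < e -> 0 < D m.
  have /cvgrPdist_lt/(_ _ Dl) := cD.
  move=> /nbhs_ballP[e /= e0 he]; exists e => // m lm.
  have := he m lm; rewrite /= ltr_norml => /andP[_].
  by rewrite ltrBlDr ltrDl.
pose d := Num.min e l.
have d0 : 0 < d by rewrite lt_min e0.
have de : d <= e by rewrite ge_min lexx.
have dl : d <= l by rewrite ge_min lexx orbT.
apply: (@expo_dense _ _ (l - d) (l + d)) => //; [by rewrite subr_ge0| |].
  by rewrite ltrBlDr -addrA ltrDl addr_gt0.
move=> m /andP[m1 m2].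
have m0 : 0 < m by apply: le_lt_trans m1; rewrite subr_ge0.
have Dm : 0 < D m.
  apply: eD; rewrite ltr_distlC; apply/andP; split.
    by apply: le_lt_trans m1; rewrite lerD2l lerN2.
  by apply: lt_le_trans m2 _; rewrite lerD2l.
have sm := sqR_expo m0.
pose N := rnorm (L2of F).
pose M := fine (\int[@lebesgue_measure R]_t (expR (m * t) * (t <= c)%R%:R)%:E).
apply: (@csub_weak _ _ _ (N * M * (`|laplace hR m| + `|laplace hI m|) / D m)) => //.
move=> r b b0 hr; pose r1 : T -> R := @complex.Re R \o L2repr r.
pose r2 : T -> R := @complex.Im R \o L2repr r.
have hrr := valP (L2repr r); have [s1 s2] := (sq_integrable_sqR _).1 hrr.
rewrite -[r]L2of_repr ip_emb// -/r1.
have hFt t := shift_sq t hF FN.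
(* the two families of real conditions come from testing [r] against the
   translates of [F] and of [i F] *)
have small1 t : `|\int[mu]_x (r1 x * hR (x + t)) + \int[mu]_x (r2 x * hI (x + t))|
    <= b * N.
  have := hr _ (VF t); rewrite -[r]L2of_repr ip_L2of// => /le_trans; apply.
  by rewrite ler_wpM2l//; exact: rnorm_shift_le.
have small2 t : `|\int[mu]_x (r2 x * hR (x + t))
    + \int[mu]_x ((- r1 x) * hI (x + t))| <= b * N.
  have := hr _ (csubZ hV 'i%C (VF t)); rewrite -L2ofZ// -[r]L2of_repr ip_L2of//.
    rewrite L2ofZ// rnormZ/= expr0n/= expr1n add0r sqrtr1 mul1r => h.
    have : b * rnorm (L2of (fun x => F (x + t))) <= b * N.
      by rewrite ler_wpM2l//; exact: rnorm_shift_le.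
    apply: le_trans; apply: le_trans h; rewrite le_eqVlt; apply/orP; left.
    apply/eqP; congr `|_|; rewrite /ipf [RHS]addrC; congr (_ + _).
      apply: eq_Rintegral => x _; rewrite /r2 /hR /=.
      by case: (F (x + t)) => p q /=; rewrite mul0r mul1r add0r.
    apply: eq_Rintegral => x _; rewrite /r1 /hI /=.
    by case: (F (x + t)) => p q /=; rewrite mul0r mul1r sub0r mulNr mulrN.
  exact: (rpredZ 'i%C (hFt t)).
have sN1 : sqR (fun x => - r1 x).
  have := sqRZ (-1) s1; rewrite (_ : (fun _ => _) = (fun x => - r1 x))//.
  by apply/funext => x; rewrite mulN1r.
have B1 := correlation_bound m0 s1 s2 sR sI hRN hRc hIN hIc small1.
have B2 := correlation_bound m0 s2 sN1 sR sI hRN hRc hIN hIc small2.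
have EN : \int[mu]_x (- r1 x * expo m x) = - \int[mu]_x (r1 x * expo m x).
  rewrite -mulN1r -RintegralZl//; last exact: integrable_mul s1 sm.
  by apply: eq_Rintegral => x _; rewrite mulN1r mulNr.
rewrite EN -/M in B2; rewrite -/M in B1.
rewrite mulrAC ler_pdivlMr//.
set R1 := \int[mu]_x (r1 x * expo m x) in B1 B2 *.
set R2 := \int[mu]_x (r2 x * expo m x) in B1 B2.
set LR := laplace hR m in B1 B2 *; set LI := laplace hI m in B1 B2 *.
rewrite -(gtr0_norm Dm) -normrM.
(* solving the two real equations for [R1] *)
have -> : R1 * D m = LR * (R1 * LR + R2 * LI) - LI * (R2 * LR + - R1 * LI).
  by rewrite /D -/LR -/LI; ring.
apply: le_trans (ler_normB _ _) _; rewrite !normrM.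
apply: le_trans (lerD (ler_wpM2l (normr_ge0 LR) B1) (ler_wpM2l (normr_ge0 LI) B2)) _.
by rewrite le_eqVlt; apply/orP; left; apply/eqP; ring.
Qed.

End span_of_translates.

(** * Lacunary sequences, divergence and compactness *)

Section lacunary_sequences.
Set Implicit Arguments.
Unset Strict Implicit.
Unset Printing Implicit Defensive.
Context {R : realType}.
Implicit Types (a b d rho : nat -> R) (q c x y t : R).

(** The suprema of the hypotheses, traded for the real bounds they provide. *)
Record lacunary_data a b q c : Prop := LacunaryData {
  lac_a0 : forall k, 0 <= a k;
  lac_ab : forall k, a k < b k;
  lac_ba : forall k, b k < a k.+1;
  lac_q0 : 0 < q;
  lac_q1 : q < 1;
  lac_q : forall k, b k <= q * a k.+1;
  lac_c : forall k, b k - a k <= c }.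

Lemma lacunary_dataP a b c : lacunary a b ->
  c%:E = ereal_sup (range (fun k => `|b k - a k|%:E)) ->
  exists q, lacunary_data a b q c.
Proof.
move=> [ab0 abk sup1] cE.
have ab k : a k < b k by case/andP: (abk k).
have ba k : b k < a k.+1 by case/andP: (abk k).
have a0 k : 0 <= a k.
  have := ab0 k (a k); rewrite /= !in_itv/= lexx (ltW (ab k))/= andbT.
  exact.
have a1 k : 0 < a k.+1 by apply: le_lt_trans (a0 k) (lt_trans (ab k) (ba k)).
set s := ereal_sup _ in sup1.
have sub k : ((b k / a k.+1)%:E <= s)%E by apply: ereal_sup_ubound; exists k.
have sfin : s \is a fin_num.
  rewrite fin_numE; apply/andP; split; apply/eqP => se.
    by have := sub 0%N; rewrite se leeNy_eq.
  by move: sup1; rewrite se.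
exists (fine s); split => //.
- rewrite -lte_fin fineK//; apply: lt_le_trans (sub 0%N).
  by rewrite lte_fin divr_gt0// (le_lt_trans (a0 0%N)).
- by rewrite -lte_fin fineK.
- by move=> k; rewrite -ler_pdivrMr// -lee_fin fineK.
- move=> k; apply: le_trans (ler_norm _) _; rewrite -lee_fin cE.
  by apply: ereal_sup_ubound; exists k.
Qed.

Section consequences.
Variables (a b : nat -> R) (q c : R).
Hypothesis lac : lacunary_data a b q c.

Lemma lac_a1 k : 0 < a k.+1.
Proof.
apply: le_lt_trans (lac_a0 lac k) _.
exact: lt_trans (lac_ab lac k) (lac_ba lac k).
Qed.

Lemma lac_c_gt0 : 0 < c.
Proof. by apply: lt_le_trans (lac_c lac 0); rewrite subr_gt0; exact: (lac_ab lac). Qed.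

Lemma lac_lt i j : (i < j)%N -> b i <= q * a j /\ b i < a j.
Proof.
have inc k : a k <= a k.+1.
  exact: ltW (lt_trans (lac_ab lac k) (lac_ba lac k)).
move=> ij; have : a i.+1 <= a j.
  elim: j ij => // j IH; rewrite ltnS leq_eqVlt => /orP[/eqP <-//|ij].
  exact: le_trans (IH ij) (inc j).
move=> aij; split; last exact: lt_le_trans (lac_ba lac i) aij.
by apply: le_trans (lac_q lac i) _; rewrite ler_pM2l//; exact: (lac_q0 lac).
Qed.

Lemma lac_geometric j m : a j <= q ^+ m * a (j + m)%N.
Proof.
elim: m => [|m IH]; first by rewrite addn0 expr0 mul1r.
apply: le_trans IH _; have q0 := lac_q0 lac; rewrite exprSr -mulrA ler_pM2l ?exprn_gt0//.
apply: le_trans (ltW (lac_ab lac _)) _; rewrite addnS; exact: (lac_q lac).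
Qed.

Lemma q_pow_lt e : 0 < e -> exists m, q ^+ m < e.
Proof.
have q0 := lac_q0 lac; move=> e0; have : (fun n => q ^+ n) @ \oo --> 0.
  by apply: cvg_expr; rewrite gtr0_norm; [exact: (lac_q1 lac)|exact: (lac_q0 lac)].
move=> /cvgrPdist_lt/(_ _ e0)[m _ /(_ m (leqnn m))].
by rewrite /= sub0r normrN gtr0_norm ?exprn_gt0 ?q0//; exists m.
Qed.

Lemma lac_unbounded x : exists K, forall k, (K <= k)%N -> x < a k.
Proof.
pose X := `|x| + 1; have X0 : 0 < X by rewrite /X ltr_wpDl.
have [m qm] := q_pow_lt (divr_gt0 (lac_a1 0) X0).
exists m.+1 => k mk.
have mono : X < a m.+1.
  have := lac_geometric 1 m; rewrite add1n => h.
  have qm0 : 0 < q ^+ m by apply: exprn_gt0; exact: (lac_q0 lac).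
  rewrite -(ltr_pM2l qm0); apply: lt_le_trans h.
  by rewrite -ltr_pdivlMr.
apply: le_lt_trans (_ : x <= X) _; first by rewrite /X ler_wpDr// ler_norm.
apply: lt_le_trans mono _; move: mk; rewrite leq_eqVlt => /orP[/eqP ->//|mk].
have [_ /ltW] := lac_lt mk; apply: le_trans; exact: ltW (lac_ab lac _).
Qed.

(** Far enough, the translates by [a k] of the parts of the system beyond its
    [k]-th interval overlap boundedly: if [y + a k] lies in the [j]-th interval
    then [a j] is comparable to [y], which leaves boundedly many [j], and
    each of them comes from a single [k] since the gaps exceed [c]. *)
Lemma overlap_count (K M : nat) y (s : seq nat) : q ^+ M < (1 - q) / 2 ->
  (forall k, (K <= k)%N -> 2 * c < (1 - q) * a k) -> uniq s ->
  (forall k, k \in s -> (K <= k)%N /\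
     exists2 j, (k < j)%N & a j <= y + a k <= b j) ->
  (size s <= M)%N.
Proof.
move=> qM hK us hs; have c0 := lac_c_gt0; have q0 := lac_q0 lac.
have q1 := lac_q1 lac.
have [jf jfP] : exists jf : nat -> nat, forall k, k \in s ->
    [/\ (K <= k)%N, (k < jf k)%N & a (jf k) <= y + a k <= b (jf k)].
  have : forall k, exists j, k \in s ->
      [/\ (K <= k)%N, (k < j)%N & a j <= y + a k <= b j].
    move=> k; case: (boolP (k \in s)) => [ks|_]; last by exists 0%N.
    by have [Kk [j kj hj]] := hs k ks; exists j.
  by move=> /boolp.choice[jf h]; exists jf => k; exact: h.
have low k : k \in s -> (1 - q) * a (jf k) <= y.
  move=> /jfP[_ kj /andP[h _]]; have [h' _] := lac_lt kj.
  have := lac_ab lac k; lra.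
have up k : k \in s -> y <= a (jf k) + c.
  move=> /jfP[_ kj /andP[_ h]]; have := lac_c lac (jf k).
  have := lac_a0 lac k; lra.
have big k : k \in s -> 2 * c < y.
  move=> ks; apply: lt_le_trans (low k ks); apply: hK.
  by have [Kk kj _] := jfP k ks; exact: leq_trans Kk (ltnW kj).
have inj : {in s &, injective jf}.
  have main k k' : k \in s -> k' \in s -> (k < k')%N -> jf k <> jf k'.
    move=> ks ks' kk' e; have [_ _ /andP[h1 _]] := jfP k ks.
    have [Kk' _ /andP[_ h2]] := jfP k' ks'; rewrite e in h1.
    have := lac_c lac (jf k'); have [h3 _] := lac_lt kk'.
    have := hK k' Kk'; have := lac_ab lac k; lra.
  move=> k k' ks ks' e; case: (ltngtP k k') => // kk'.
    by case: (main k k').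
  by case: (main k' k).
(* indices [M] apart would make [a] jump by more than the factor that
   separates the bounds [low] and [up] *)
have close k k' : k \in s -> k' \in s -> (jf k' < jf k + M)%N.
  move=> ks ks'; rewrite ltnNge; apply/negP => h.
  have E : (jf k + (jf k' - jf k) = jf k')%N.
    by rewrite subnKC// (leq_trans _ h)// leq_addr.
  have := lac_geometric (jf k) (jf k' - jf k); rewrite E => g.
  have qle : q ^+ (jf k' - jf k) <= q ^+ M.
    by apply: ler_wiXn2l; [exact: ltW|exact: ltW|rewrite leq_subRL// (leq_trans _ h)// leq_addr].
  have a'0 := lac_a0 lac (jf k').
  have g' : a (jf k) <= (1 - q) / 2 * a (jf k').
    apply: le_trans g _; apply: ler_wpM2r => //.
    exact: le_trans qle (ltW qM).
  have := up k ks; have := low k' ks'; have := big k ks; lra.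
case: s us hs jfP low up big inj close => [//|k0 s0].
set s := k0 :: s0 => us hs jfP low up big inj close.
have exj : exists j, j \in map jf s by exists (jf k0); rewrite /s mem_head.
have [jm jms jmin] := ex_minnP exj.
rewrite -(size_map jf) -(size_iota jm M); apply: uniq_leq_size.
  by rewrite map_inj_in_uniq.
move=> j jS; rewrite mem_iota (jmin j jS)/=.
by move: jS jms => /mapP[k ks ->] /mapP[k' ks' ->]; exact: close.
Qed.

End consequences.

(** From [rho k <= rho k.+1 * (1 + N2 k / rho k.+1)] one gets
    [rho 0 <= rho n * expR (\sum_(k < n) N2 k / rho k.+1)]; if the sums were
    bounded, [rho] would stay away from [0]. *)
Lemma defects_diverge (N2 : nat -> R) rho : (forall k, 0 < rho k) ->
  (forall k, rho k <= rho k.+1 + N2 k) -> rho @ \oo --> 0 ->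
  forall M, exists n, M < \sum_(k < n) N2 k / rho k.+1.
Proof.
move=> r0 rN rc M; apply: contrapT => hn.
have hM n : \sum_(k < n) N2 k / rho k.+1 <= M.
  by rewrite leNgt; apply/negP => h; apply: hn; exists n.
have key n : rho 0%N <= rho n * expR (\sum_(k < n) N2 k / rho k.+1).
  elim: n => [|n IH]; first by rewrite big_ord0 expR0 mulr1.
  apply: le_trans IH _; rewrite big_ord_recr/= addrC expRD mulrA.
  rewrite ler_pM2r ?expR_gt0//; apply: le_trans (rN n) _.
  apply: le_trans (_ : _ <= rho n.+1 * (1 + N2 n / rho n.+1)) _.
    by rewrite mulrDr mulr1 mulrCA divff ?gt_eqF// mulr1.
  by rewrite ler_pM2l//; exact: expR_ge1Dx.
have e0 : 0 < rho 0%N * expR (- M) by rewrite mulr_gt0// expR_gt0.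
move: rc => /cvgrPdist_lt/(_ _ e0)[n _ /(_ n (leqnn n))].
rewrite /= sub0r normrN gtr0_norm// ltNge => /negP; apply.
rewrite expRN ler_pdivrMr ?expR_gt0//; apply: le_trans (key n) _.
by rewrite ler_pM2l// ler_expR.
Qed.

(** A divergent weight carried by a sequence in a compact set is already
    divergent near some point: the sets whose complement carries a convergent
    weight form a proper filter, which clusters. *)
Lemma compact_heavy_point (X : topologicalType) (A : set X) (u : nat -> X) d :
  compact A -> (forall k, A (u k)) -> (forall k, 0 <= d k) ->
  (forall M, exists n, M < \sum_(k < n) d k) ->
  exists2 h, A h & forall B, nbhs h B ->
    forall M, exists n, M < \sum_(k < n | `[< B (u k) >]) d k.
Proof.
move=> cA Au d0 dd.
pose light (S : set X) := exists M, forall n,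
  \sum_(k < n | ~~ `[< S (u k) >]) d k <= M.
have lightF : ProperFilter light.
  apply: Build_ProperFilter_ex; last split.
  - move=> S [M hM]; apply: contrapT => Sn; have [n] := dd M.
    rewrite ltNge => /negP; apply; apply: le_trans (hM n).
    rewrite [leRHS](eq_bigl xpredT)// => k.
    by apply/negP => /asboolP Sk; apply: Sn; exists (u k).
  - exists 0 => n; rewrite big_pred0// => k.
    by apply/negbTE; rewrite negbK; exact/asboolP.
  - move=> S S' [M hM] [M' hM']; exists (M + M') => n.
    apply: le_trans (lerD (hM n) (hM' n)).
    rewrite [X in _ <= X + _]big_mkcond [X in _ <= _ + X]big_mkcond/=.
    rewrite -big_split/= [leLHS]big_mkcond/=.
    apply: ler_sum => k _; case: asboolP => [|nSS'].
      by move=> [Sk S'k]; rewrite !asboolT//= addr0.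
    case: asboolP => Sk; case: asboolP => S'k /=; rewrite ?addr0 ?add0r//.
    + by case: nSS'.
    + by rewrite lerDl.
  - move=> S S' SS' [M hM]; exists M => n; apply: le_trans (hM n).
    rewrite big_mkcond [leRHS]big_mkcond; apply: ler_sum => k _.
    case: asboolP => S'k; case: asboolP => Sk //=.
    by case: S'k; exact: SS'.
have lightA : light A.
  exists 0 => n; rewrite big_pred0// => k.
  by apply/negbTE; rewrite negbK; exact/asboolP.
have [h [Ah ch]] := cA light lightF lightA.
exists h => // B hB M; apply: contrapT => hn.
have lB : light (~` B).
  exists M => n; rewrite leNgt; apply/negP => h'; apply: hn; exists n.
  apply: lt_le_trans h' _; rewrite le_eqVlt; apply/orP; left; apply/eqP.
  apply: eq_bigl => k; rewrite -asbool_neg; apply/asboolP/asboolP => /=.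
    by move=> /contrapT.
  by move=> ? ?.
by have [z [nBz Bz]] := ch _ _ lB hB.
Qed.

(** Used twice: with weights of sum 1, where it is convexity, and with weights
    that are the indicator of at most [M] indices, where it bounds the square of
    a sum with few nonzero terms. *)
Lemma weighted_cauchy (I : Type) (r : seq I) (P : pred I) (al x : I -> R) :
  (forall i, P i -> 0 <= al i) ->
  (\sum_(i <- r | P i) al i * x i) ^+ 2 <=
  (\sum_(i <- r | P i) al i) * \sum_(i <- r | P i) al i * x i ^+ 2.
Proof.
move=> al0; elim: r => [|i r IH]; first by rewrite !big_nil mul0r expr0n.
rewrite !big_cons; case: ifP => Pi //.
set A := \sum_(j <- r | P j) al j in IH *.
set B := \sum_(j <- r | P j) al j * x j in IH *.
set D := \sum_(j <- r | P j) al j * x j ^+ 2 in IH *.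
have ai := al0 i Pi.
have A0 : 0 <= A by exact: sumr_ge0.
have D0 : 0 <= D by apply: sumr_ge0 => j Pj; rewrite mulr_ge0 ?sqr_ge0 ?al0.
have : 0 <= al i * (A * x i ^+ 2 - 2 * B * x i + D).
  apply: mulr_ge0 => //; have [A00|An0] := eqVneq A 0.
    have B0 : B = 0.
      by apply/eqP; rewrite -sqrf_eq0 eq_le sqr_ge0 andbT; rewrite A00 mul0r in IH.
    by rewrite A00 B0; lra.
  have Ap : 0 < A by rewrite lt_def An0.
  rewrite -(pmulr_rge0 _ Ap).
  have -> : A * (A * x i ^+ 2 - 2 * B * x i + D) =
    (A * x i - B) ^+ 2 + (A * D - B ^+ 2) by ring.
  by rewrite addr_ge0 ?sqr_ge0// subr_ge0.
move: IH; nra.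
Qed.

End lacunary_sequences.

(** * Supports and finite sums *)

Section cutting_and_sums.
Set Implicit Arguments.
Unset Strict Implicit.
Unset Printing Implicit Defensive.
Context {R : realType}.
Local Notation C := R[i].
Local Notation mu := (muRp R).
Local Notation T := (measurableTypeR R).
Implicit Types (F G : T -> C) (A : set T) (t : R).

Lemma csqZ (x : R) z : csq (x%:C%C * z) = x ^+ 2 * csq z.
Proof. by case: z => p q; rewrite /csq; simpc; rewrite /=; ring. Qed.

Lemma csqB_le (z w : C) : csq (z - w) <= 2 * csq z + 2 * csq w.
Proof.
case: z w => p q [r s]; rewrite /csq /=.
have := sqr_ge0 (p + r); have := sqr_ge0 (q + s); nra.
Qed.

Lemma csq_sum_le (I : Type) (r : seq I) (al : I -> R) (z : I -> C) :
  (forall i, 0 <= al i) ->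
  csq (\sum_(i <- r) (al i)%:C%C * z i) <=
  (\sum_(i <- r) al i) * \sum_(i <- r) al i * csq (z i).
Proof.
move=> al0; rewrite /csq.
have -> : complex.Re (\sum_(i <- r) (al i)%:C%C * z i)
    = \sum_(i <- r) al i * complex.Re (z i).
  elim: r => [|i r IH]; first by rewrite !big_nil.
  rewrite !big_cons -IH; case: (z i) (\sum_(_ <- _) _) => p q [u v]; by simpc.
have -> : complex.Im (\sum_(i <- r) (al i)%:C%C * z i)
    = \sum_(i <- r) al i * complex.Im (z i).
  elim: r => [|i r IH]; first by rewrite !big_nil.
  rewrite !big_cons -IH; case: (z i) (\sum_(_ <- _) _) => p q [u v]; by simpc.
apply: le_trans (lerD (weighted_cauchy _ _ _) (weighted_cauchy _ _ _)) _ => //.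
rewrite -mulrDr -big_split/= le_eqVlt; apply/orP; left; apply/eqP.
by congr (_ * _); apply: eq_bigr => i _; rewrite mulrDr.
Qed.

Definition truncate A F : T -> C := fun x => (\1_A x : R)%:C%C * F x.

Lemma truncate_in A F x : A x -> truncate A F x = F x.
Proof. by move=> Ax; rewrite /truncate indicE mem_set// mul1r. Qed.

Lemma truncate_out A F x : ~ A x -> truncate A F x = 0.
Proof. by move=> Ax; rewrite /truncate indicE memNset// mul0r. Qed.

Lemma csq_truncate_le A F x : csq (truncate A F x) <= csq (F x).
Proof.
rewrite /truncate csqZ indicE; case: (_ \in _).
  by rewrite expr1n mul1r.
by rewrite expr0n mul0r csq_ge0.
Qed.

Lemma truncate_sq A F : measurable A -> F \in @sq_integrable R ->
  truncate A F \in @sq_integrable R.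
Proof.
move=> mA /sq_integrableE[[mr mi] fin]; apply/sq_integrableE.
have mI : measurable_fun setT (\1_A : T -> R) by exact: measurable_indic.
have cm : cmeasurable (truncate A F).
  split.
    rewrite (_ : _ \o _ = (fun x => \1_A x * complex.Re (F x))).
      exact: measurable_funM.
    by apply/funext => x; rewrite /truncate/=; case: (F x) => p q; simpc.
  rewrite (_ : _ \o _ = (fun x => \1_A x * complex.Im (F x))).
    exact: measurable_funM.
  by apply/funext => x; rewrite /truncate/=; case: (F x) => p q; simpc.
split => //; apply: le_lt_trans fin; apply: ge0_le_integral => //.
- by move=> x _; rewrite lee_fin csq_ge0.
- exact: emeasurable_csq.
- exact: emeasurable_csq.
- by move=> x _; rewrite lee_fin csq_truncate_le.
Qed.

Lemma L2of_sum (I : Type) (r : seq I) (g : I -> C) (F : I -> T -> C) :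
  (forall i, F i \in @sq_integrable R) ->
  (fun x => \sum_(i <- r) g i * F i x) \in @sq_integrable R /\
  L2of (fun x => \sum_(i <- r) g i * F i x) = \sum_(i <- r) g i *: L2of (F i).
Proof.
move=> hF; elim: r => [|i r [IH1 IH2]].
  rewrite big_nil (_ : (fun _ => _) = (fun=> 0)); last first.
    by apply/funext => x; rewrite big_nil.
  by split; [exact: (rpred0 (@sq_integrable R))|exact: L2of0].
rewrite big_cons (_ : (fun _ => _) =
  (fun x => g i * F i x + \sum_(j <- r) g j * F j x)); last first.
  by apply/funext => x; rewrite big_cons.
have hg : (fun x => g i * F i x) \in @sq_integrable R by exact: (rpredZ (g i) (hF i)).
split; first exact: (rpredD hg IH1).
by rewrite L2ofD// L2ofZ// IH2.
Qed.

Lemma sq_integrableB F G : F \in @sq_integrable R -> G \in @sq_integrable R ->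
  (fun x => F x - G x) \in @sq_integrable R.
Proof. by move=> hF hG; exact: (rpredB hF hG). Qed.

Lemma L2ofB F G : F \in @sq_integrable R -> G \in @sq_integrable R ->
  L2of (fun x => F x - G x) = L2of F - L2of G.
Proof.
move=> hF hG; rewrite -[- L2of G]scaleN1r -L2ofZ// -L2ofD//.
  by congr L2of; apply/funext => x; rewrite mulN1r.
exact: (rpredZ (-1) hG).
Qed.

Lemma Sstar_L2of F t : 0 <= t -> F \in @sq_integrable R ->
  Sstar t (L2of F) = L2of (fun x => F (x + t)).
Proof.
move=> t0 hF; apply: L2of_eq.
- exact: (translate_sq t0 (valP (L2repr (L2of F)))).
- exact: translate_sq.
- exact: (ae_translate t0 (L2of_ae hF)).
Qed.

Lemma block_L2of (a b : R) F : 0 <= a -> F \in @sq_integrable R ->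
  block a b (L2of F) = L2of (fun x => if 0 <= x <= b - a then F (x + a) else 0).
Proof.
move=> a0 hF; apply: L2of_eq.
- exact: (window_sq (b - a) (translate_sq a0 (valP (L2repr (L2of F))))).
- exact: (window_sq (b - a) (translate_sq a0 hF)).
- apply: (@filterS _ _ (ae_filter_ringOfSetsType mu) _ _ _
    (ae_translate a0 (L2of_ae hF))) => x e; by case: ifP.
Qed.

(** The line is second countable, so a function vanishes almost everywhere off
    its support. *)
Lemma L2supp_ae (u : L2 R) :
  {ae mu, forall x, ~ L2supp u x -> L2repr u x = 0}.
Proof.
pose Z (pq : rat * rat) :=
  {ae mu, forall x : R, ratr pq.1 < x < ratr pq.2 -> L2repr u x = 0}.
have : {ae mu, forall x (n : nat), forall pq, unpickle n = Some pq -> Z pq ->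
    ratr pq.1 < x < ratr pq.2 -> L2repr u x = 0}.
  apply: ae_foralln => n; case: (unpickle n) => [pq|]; last exact: aeW.
  have [Zpq|nZ] := pselect (Z pq); last by apply: aeW => x _ [<-].
  apply: (@filterS _ _ (ae_filter_ringOfSetsType mu) _ _ _ Zpq).
  by move=> x h _ [<-] _; exact: h.
apply: (@filterS _ _ (ae_filter_ringOfSetsType mu)) => x hx.
rewrite /L2supp /= => /contrapT[U [oU aU] Ux].
have /nbhs_ballP[e /= e0 sU] := open_nbhs_nbhs (conj oU Ux).
have [p] := @rat_in_itvoo R (x - e) x ltac:(by rewrite ltrBlDr ltrDl).
have [q] := @rat_in_itvoo R x (x + e) ltac:(by rewrite ltrDl).
rewrite !in_itv/= => /andP[xq qe] /andP[ep px].
apply: (hx (pickle (p, q)) (p, q)); first by rewrite pickleK.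
  apply: (@filterS _ _ (ae_filter_ringOfSetsType mu) _ _ _ aU).
  move=> y Uy /= /andP[py yq]; apply: Uy; apply: sU.
  rewrite /ball/= ltr_distlC (lt_trans ep py)/=.
  exact: lt_trans yq qe.
by rewrite /= px xq.
Qed.

Lemma L2supp_representative (u : L2 R) A : measurable A -> L2supp u `<=` A ->
  exists F, [/\ F \in @sq_integrable R, L2of F = u & forall x, ~ A x -> F x = 0].
Proof.
move=> mA sA; have hu := valP (L2repr u).
exists (truncate A (L2repr u)); split; first exact: truncate_sq.
  rewrite -[RHS]L2of_repr; apply: L2of_eq => //; first exact: truncate_sq.
  apply: (@filterS _ _ (ae_filter_ringOfSetsType mu) _ _ _ (L2supp_ae u)) => x hx.
  have [Ax|nAx] := pselect (A x); first exact: truncate_in.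
  by rewrite truncate_out// hx// => /sA.
by move=> x; exact: truncate_out.
Qed.

End cutting_and_sums.

(** * Pieces and rests of a lacunary function *)

Section averaging.
Set Implicit Arguments.
Unset Strict Implicit.
Unset Printing Implicit Defensive.
Context {R : realType}.
Local Notation C := R[i].
Local Notation mu := (muRp R).
Local Notation T := (measurableTypeR R).
Variables (a b : nat -> R) (q c : R) (F : T -> C).
Hypothesis lac : lacunary_data a b q c.
Hypothesis hF : F \in @sq_integrable R.
Hypothesis F0 : forall x, ~ (exists k, a k <= x <= b k) -> F x = 0.

Definition piece k : T -> C :=
  fun x => if 0 <= x <= b k - a k then F (x + a k) else 0.

Definition rest k : T -> C := truncate `[a k, +oo[%classic F.

Definition energy k : R := rnorm (L2of (rest k)) ^+ 2.

(** The energy of a piece relative to that of everything after it: the inverse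
    of the price for isolating the piece by a translation. *)
Definition relative_energy k : R := rnorm (L2of (piece k)) ^+ 2 / energy k.+1.

Lemma F_neg x : x < 0 -> F x = 0.
Proof.
move=> x0; apply: F0 => -[k /andP[ax _]].
by have := le_lt_trans ax x0; rewrite ltNge (lac_a0 lac).
Qed.

Lemma piece_sq k : piece k \in @sq_integrable R.
Proof. exact: (window_sq (b k - a k) (translate_sq (lac_a0 lac k) hF)). Qed.

Lemma rest_sq k : rest k \in @sq_integrable R.
Proof. by apply: truncate_sq => //; exact: measurable_itv. Qed.

Lemma piece_neg k x : x < 0 -> piece k x = 0.
Proof. by rewrite /piece ltNge => /negbTE ->. Qed.

Lemma rest_in k x : a k <= x -> rest k x = F x.
Proof. by move=> ax; rewrite /rest truncate_in//= in_itv/= ax. Qed.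

Lemma rest_out k x : x < a k -> rest k x = 0.
Proof.
by move=> ax; rewrite /rest truncate_out//= in_itv/= andbT => /(lt_le_trans ax); rewrite ltxx.
Qed.

Lemma rest_neg k x : x < 0 -> rest k x = 0.
Proof. by move=> x0; rewrite rest_out// (lt_le_trans x0)// (lac_a0 lac). Qed.

(** Beyond the preceding intervals, [F] shifted by [a k] is its [k]-th piece
    followed by the rest. *)
Lemma split_piece k y : (forall j, (j < k)%N -> b j < y + a k) ->
  F (y + a k) = piece k y + rest k.+1 (y + a k).
Proof.
move=> hy; set z := y + a k.
have yz : (0 <= y <= b k - a k) = (a k <= z <= b k).
  by rewrite /z lerDr lerBrDr.
rewrite /piece yz -/z; case: ifP => [/andP[_ zb]|nz].
  by rewrite rest_out ?addr0// (le_lt_trans zb)// (lac_ba lac).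
rewrite add0r; have [az|za] := leP (a k.+1) z; first by rewrite rest_in.
rewrite rest_out//; apply: F0 => -[j /andP[aj jb]].
have [jk|kj|jk] := ltngtP j k.
- by have := lt_le_trans (hy j jk) jb; rewrite ltxx.
- have : a k.+1 <= a j.
    move: kj; rewrite leq_eqVlt => /orP[/eqP <-//|kj].
    have [_ h] := lac_lt lac kj; apply: ltW; exact: lt_trans (lac_ab lac _) h.
  by move=> /le_trans/(_ aj)/(lt_le_trans za); rewrite ltxx.
- by move: nz; rewrite -jk aj jb.
Qed.

(** The gap between two intervals carries nothing. *)
Lemma energy_step k : energy k <= energy k.+1 + rnorm (L2of (piece k)) ^+ 2.
Proof.
have hr := rest_sq k; have hr' := rest_sq k.+1; have hp := piece_sq k.
have hps := shift_sq (- a k) hp (@piece_neg k).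
rewrite -lee_fin EFinD /energy !rnorm_sqE//.
have E x : csq (rest k x) <= csq (rest k.+1 x) + csq (piece k (x - a k)).
  have [ax|xa] := leP (a k) x; last first.
    rewrite rest_out// {1}/csq /= expr0n addr0.
    by rewrite addr_ge0// csq_ge0.
  rewrite rest_in//.
  have := @split_piece k (x - a k); rewrite subrK => ->; last first.
    by move=> j jk; have [_ h] := lac_lt lac jk; exact: lt_le_trans h ax.
  rewrite /piece; case: ifP => [/andP[_ xb]|_].
    rewrite subrK lerBrDr subrK in xb *.
    by rewrite rest_out ?addr0 ?lerDr ?csq_ge0// (le_lt_trans xb)// (lac_ba lac).
  by rewrite add0r lerDl csq_ge0.
have m1 : measurable_fun setT (fun x => (csq (rest k.+1 x))%:E).
  by apply: emeasurable_csq; case/sq_integrableE: hr'.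
have m2 : measurable_fun setT (fun x : T => (csq (piece k (x - a k)%R))%:E).
  by apply: emeasurable_csq; case/sq_integrableE: hps.
have m3 : measurable_fun setT (fun x => (csq (piece k x))%:E).
  by apply: emeasurable_csq; case/sq_integrableE: hp.
apply: (@le_trans _ _ (\int[mu]_x ((csq (rest k.+1 x))%:E
    + (csq (piece k (x - a k)))%:E))%E).
  apply: ge0_le_integral => //.
  - by move=> x _; rewrite lee_fin csq_ge0.
  - by apply: emeasurable_csq; case/sq_integrableE: hr.
  - exact: emeasurable_funD.
  - by move=> x _; rewrite -EFinD lee_fin.
rewrite ge0_integralD//; first last.
- by move=> x _; rewrite lee_fin csq_ge0.
- by move=> x _; rewrite lee_fin csq_ge0.
rewrite leeD2l//; apply: (ge0_shift_le (g := fun x => (csq (piece k x))%:E)) => //.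
- by move=> x; rewrite lee_fin csq_ge0.
- by move=> x x0; rewrite piece_neg// /csq/= expr0n addr0.
Qed.

Lemma piece_le_energy k : rnorm (L2of (piece k)) ^+ 2 <= energy k.
Proof.
have hr := rest_sq k; have hp := piece_sq k.
rewrite -lee_fin /energy !rnorm_sqE//.
have hs := shift_sq (a k) hr (@rest_neg k).
apply: (@le_trans _ _ (\int[mu]_x (csq (rest k (x + a k)))%:E)%E).
  apply: ge0_le_integral => //.
  - by move=> x _; rewrite lee_fin csq_ge0.
  - by apply: emeasurable_csq; case/sq_integrableE: hp.
  - by apply: emeasurable_csq; case/sq_integrableE: hs.
  - move=> x _; rewrite lee_fin /piece; case: ifP => [/andP[x0 _]|_].
      by rewrite rest_in// lerDr.
    by rewrite {1}/csq /= expr0n addr0 csq_ge0.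
apply: (ge0_shift_le (g := fun x => (csq (rest k x))%:E)).
- by apply: emeasurable_csq; case/sq_integrableE: hr.
- by move=> x; rewrite lee_fin csq_ge0.
- by move=> x x0; rewrite rest_neg// /csq/= expr0n addr0.
Qed.

Lemma energy_cvg0 : energy @ \oo --> 0.
Proof.
have [mF IF] := (sq_integrableE F).1 hF.
have [_ _] : [/\ mu.-integrable setT (cst 0%E : T -> \bar R),
   [sequence \int[mu]_x `|(csq (rest n x))%:E - cst 0 x|]_n @ \oo --> 0%E &
   [sequence \int[mu]_x (csq (rest n x))%:E]_n @ \oo -->
     \int[mu]_x (cst 0 x : \bar R)]%E.
  apply: (@dominated_convergence _ T R mu setT measurableT _ _
    (fun x => (csq (F x))%:E)) => //.
  - by move=> n; apply: emeasurable_csq; case/sq_integrableE: (rest_sq n).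
  - apply: aeW => x _; have [K hK] := lac_unbounded lac x.
    apply: cvg_near_cst; exists K => // n /= Kn.
    by rewrite rest_out ?hK// /csq/= expr0n addr0.
  - apply/integrableP; split; first exact: emeasurable_csq.
    by under eq_integral do rewrite abse_EFin ger0_norm ?csq_ge0//.
  - apply: aeW => x n _; rewrite abse_EFin ger0_norm ?csq_ge0//.
    by rewrite lee_fin csq_truncate_le.
rewrite integral0 => /fine_cvgP[_ h].
rewrite (_ : energy = fine \o [sequence \int[mu]_x (csq (rest n x))%:E]_n%E).
  exact: h.
by apply/funext => n /=; rewrite -rnorm_sqE//; exact: rest_sq.
Qed.

Lemma relative_energy_ge0 k : 0 <= relative_energy k.
Proof. by rewrite divr_ge0 ?sqr_ge0. Qed.

Lemma sum_drop (P : pred nat) (d : nat -> R) : (forall k, 0 <= d k) ->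
  (forall A, exists n, A < \sum_(k < n | P k) d k) ->
  forall K A, exists n, A < \sum_(k < n | P k && (K <= k)%N) d k.
Proof.
move=> d0 hd; elim=> [|K IH] A.
  by have [n hn] := hd A; exists n; under eq_bigl do rewrite andbT.
have [n hn] := IH (A + d K); exists n.
have : \sum_(k < n | P k && (K <= k)%N) d k <=
    \sum_(k < n | P k && (K < k)%N) d k + \sum_(k < n | k == K :> nat) d k.
  rewrite big_mkcond [X in _ <= X + _]big_mkcond [X in _ <= _ + X]big_mkcond/=.
  rewrite -big_split/=; apply: ler_sum => k _; case: (P k) => /=; last first.
    by rewrite add0r; case: ifP.
  by case: ltngtP => _; rewrite ?addr0 ?add0r.
have : \sum_(k < n | k == K :> nat) d k <= d K.
  have [Kn|nK] := ltnP K n.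
    rewrite (big_pred1 (Ordinal Kn))//.
  rewrite big_pred0// => k; apply/negbTE; rewrite neq_ltn.
  by rewrite (leq_trans (ltn_ord k) nK).
move: hn; lra.
Qed.

Hypothesis piece_neq0 : forall k, L2of (piece k) != 0.

Lemma piece_norm_gt0 k : 0 < rnorm (L2of (piece k)).
Proof.
rewrite lt_def rnorm_ge0 andbT; apply/eqP => /rnorm_eq0 p0.
by have := piece_neq0 k; rewrite p0 eqxx.
Qed.

Lemma energy_gt0 k : 0 < energy k.
Proof.
by apply: lt_le_trans (piece_le_energy k); rewrite exprn_gt0// piece_norm_gt0.
Qed.

Lemma relative_energy_diverge A : exists n, A < \sum_(k < n) relative_energy k.
Proof.
exact: (defects_diverge energy_gt0 energy_step energy_cvg0).
Qed.

(** Wherever the [k]-th rest does not vanish, the point lies in some later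
    interval, so that [overlap_count] applies. *)
Lemma overlap_bound (K M n : nat) y (P : pred nat) : q ^+ M < (1 - q) / 2 ->
  (forall k, (K <= k)%N -> 2 * c < (1 - q) * a k) ->
  \sum_(k <- index_iota 0 n | P k && (K <= k)%N)
    (rest k.+1 (y + a k) != 0)%R%:R <= M%:R :> R.
Proof.
move=> qM hK; rewrite -big_filter; set J := [seq k <- _ | _].
have -> : \sum_(k <- J) (rest k.+1 (y + a k) != 0)%R%:R =
    (size [seq k <- J | rest k.+1 (y + a k)%R != 0%R])%:R :> R.
  rewrite size_filter -sum1_count natr_sum [RHS]big_mkcond/=.
  by apply: eq_bigr => k _; case: ifP.
rewrite ler_nat; apply: (overlap_count lac qM hK (y := y)).
  by rewrite !filter_uniq// iota_uniq.
move=> k; rewrite !mem_filter => /andP[rk /andP[/andP[_ Kk] _]]; split => //.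
have az : a k.+1 <= y + a k.
  by rewrite leNgt; apply/negP => h; move: rk; rewrite rest_out ?eqxx.
have [[j jz]|nj] := pselect (exists j, a j <= y + a k <= b j); last first.
  by move: rk; rewrite rest_in// F0// eqxx.
exists j => //; rewrite ltnNge; apply/negP => jk.
have [_ h] := @lac_lt _ _ _ _ _ lac j k.+1 jk; case/andP: jz => _ jb.
by have := lt_le_trans h (le_trans az jb); rewrite ltxx.
Qed.

End averaging.

(** * Averages of translates *)

Lemma shift_gap (R : realType) (q c t x : R) : 0 < c ->
  2 * c + `|t| < (1 - q) * x -> q * x < t + x.
Proof. by move=> c0 h; have := ler_norm (- t); rewrite normrN; lra. Qed.

Lemma average_error (R : realType) (e m W : R) : 0 < e -> 0 < W ->
  4 * m / e ^+ 2 < W -> 2 * (e / 2) ^+ 2 + 2 * m / W < e ^+ 2.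
Proof.
move=> e0 W0; rewrite ltr_pdivrMr ?exprn_gt0// => h.
have -> : 2 * (e / 2) ^+ 2 = e ^+ 2 / 2 by field.
rewrite -ltrBrDl ltr_pdivrMr//; lra.
Qed.

Section averages.
Set Implicit Arguments.
Unset Strict Implicit.
Unset Printing Implicit Defensive.
Context {R : realType}.
Local Notation C := R[i].
Local Notation mu := (muRp R).
Local Notation T := (measurableTypeR R).
Variables (a b : nat -> R) (q c : R) (F : T -> C).
Hypothesis lac : lacunary_data a b q c.
Hypothesis hF : F \in @sq_integrable R.
Hypothesis F0 : forall x, ~ (exists k, a k <= x <= b k) -> F x = 0.
Hypothesis piece_neq0 : forall k, L2of (piece a b F k) != 0.
Variables (h : T -> C).
Hypothesis hh : h \in @sq_integrable R.
Hypothesis h_neg : forall x, x < 0 -> h x = 0.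

Let N k := rnorm (L2of (piece a b F k)).
Let N_gt0 k : 0 < N k. Proof. exact: piece_norm_gt0. Qed.
Let dev k : T -> C := fun x => h x - (N k)^-1%:C%C * piece a b F k x.

Let dev_sq k : dev k \in @sq_integrable R.
Proof.
by apply: sq_integrableB => //; exact: (rpredZ _ (piece_sq lac hF k)).
Qed.

Let dev_neg k x : x < 0 -> dev k x = 0.
Proof. by move=> x0; rewrite /dev h_neg// piece_neg// mulr0 subrr. Qed.

Let L2of_dev k : L2of (dev k) = L2of h - (N k)^-1%:C%C *: L2of (piece a b F k).
Proof.
have hp := piece_sq lac hF k; rewrite L2ofB//; last exact: (rpredZ _ hp).
by rewrite L2ofZ.
Qed.

(** The rests may overlap, but at most [M] of them at a point, so that the
    square of their sum costs only a factor [M]. *)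
Lemma average_pointwise (J : seq nat) (w : nat -> R) (M : nat) y :
  (forall k, 0 <= w k) -> \sum_(k <- J) w k = 1 ->
  (forall k j, k \in J -> (j < k)%N -> b j < y + a k) ->
  \sum_(k <- J) (rest a F k.+1 (y + a k) != 0)%R%:R <= M%:R :> R ->
  csq (h y - \sum_(k <- J) (w k / N k)%:C%C * F (y + a k)) <=
  \sum_(k <- J) (2 * w k * csq (dev k y)
    + 2 * M%:R * (w k / N k) ^+ 2 * csq (rest a F k.+1 (y + a k))).
Proof.
move=> w0 w1 hJ hM.
pose z k := rest a F k.+1 (y + a k).
pose chi k : R := (z k != 0)%R%:R.
have zE k : (w k / N k)%:C%C * z k = (chi k)%:C%C * ((w k / N k)%:C%C * z k).
  by rewrite /chi; case: eqP => [->|_]; rewrite /= ?mulr0 ?mul1r.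
have -> : h y - \sum_(k <- J) (w k / N k)%:C%C * F (y + a k) =
    \sum_(k <- J) (w k)%:C%C * dev k y
    - \sum_(k <- J) (chi k)%:C%C * ((w k / N k)%:C%C * z k).
  have -> : h y = \sum_(k <- J) (w k)%:C%C * h y.
    by rewrite -mulr_suml -rmorph_sum w1 mul1r.
  rewrite -!sumrB; apply: eq_big_seq => k kJ; rewrite -zE (split_piece lac F0).
    by rewrite /dev /z rmorphM; ring.
  by move=> j; exact: hJ.
apply: le_trans (csqB_le _ _) _; rewrite big_split/=; apply: lerD.
  apply: le_trans (ler_wpM2l _ (csq_sum_le _ _ w0)) _ => //.
  by rewrite w1 mul1r mulr_sumr; apply: ler_sum => k _; rewrite mulrA.
have chi0 k : 0 <= chi k by rewrite /chi ler0n.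
apply: le_trans (ler_wpM2l _ (csq_sum_le _ _ chi0)) _ => //.
have S0 : 0 <= \sum_(k <- J) chi k * csq ((w k / N k)%:C%C * z k).
  by apply: sumr_ge0 => k _; rewrite mulr_ge0 ?csq_ge0.
apply: le_trans (ler_wpM2l _ (ler_wpM2r S0 hM)) _ => //.
rewrite mulrA mulr_sumr; apply: ler_sum => k _.
rewrite -[leRHS]mulrA; apply: ler_wpM2l; first by rewrite mulr_ge0.
rewrite csqZ ler_piMl//; first by apply: mulr_ge0; [exact: sqr_ge0|exact: csq_ge0].
by rewrite /chi lern1 leq_b1.
Qed.

Lemma average_rnorm (J : seq nat) (w : nat -> R) (M : nat) t :
  (forall k, 0 <= w k) -> \sum_(k <- J) w k = 1 ->
  (forall k j, k \in J -> (j < k)%N -> b j < t + a k) ->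
  (forall y, \sum_(k <- J) (rest a F k.+1 (y + a k) != 0)%R%:R <= M%:R :> R) ->
  rnorm (L2of (fun x => h (x + t)) -
    \sum_(k <- J) (w k / N k)%:C%C *: L2of (fun x => F (x + (t + a k)))) ^+ 2 <=
  \sum_(k <- J) (2 * w k * rnorm (L2of (dev k)) ^+ 2
    + 2 * M%:R * (w k / N k) ^+ 2 * energy a F k.+1).
Proof.
move=> w0 w1 hJ hM.
have FN := F_neg lac F0.
have sF k := shift_sq (t + a k) hF FN.
have sh := shift_sq t hh h_neg.
have [sS <-] := L2of_sum J (fun k => (w k / N k)%:C%C) sF.
rewrite -L2ofB// -lee_fin rnorm_sqE; last exact: sq_integrableB.
pose D k := dev k; pose S k := rest a F k.+1.
have hS k : S k \in @sq_integrable R by exact: rest_sq.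
have SN k x : x < 0 -> S k x = 0 by exact: (rest_neg F lac).
have sD k := shift_sq t (dev_sq k) (@dev_neg k).
have sS' k := shift_sq (t + a k) (hS k) (SN k).
pose phi k (x : T) : \bar R := ((2 * w k)%:E * (csq (dev k (x + t)))%:E
  + (2 * M%:R * (w k / N k) ^+ 2)%:E * (csq (S k (x + (t + a k))))%:E)%E.
have mD k : measurable_fun setT (fun x : T => (csq (dev k (x + t)))%:E).
  by apply: emeasurable_csq; case/sq_integrableE: (sD k).
have mS k : measurable_fun setT (fun x : T => (csq (S k (x + (t + a k))))%:E).
  by apply: emeasurable_csq; case/sq_integrableE: (sS' k).
have c1 k : 0 <= 2 * w k by rewrite mulr_ge0.
have c2 k : 0 <= 2 * M%:R * (w k / N k) ^+ 2 by apply: mulr_ge0; [exact: mulr_ge0|exact: sqr_ge0].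
have phi0 k x : (0 <= phi k x)%E.
  by rewrite /phi adde_ge0// -EFinM lee_fin mulr_ge0 ?csq_ge0.
have mphi k : measurable_fun setT (phi k).
  by apply: emeasurable_funD; apply: measurable_funeM.
apply: (@le_trans _ _ (\int[mu]_x \sum_(k <- J) phi k x)%E).
  apply: ae_ge0_le_integral => //.
  - by move=> x _; rewrite lee_fin csq_ge0.
  - by apply: emeasurable_csq; case/sq_integrableE: (sq_integrableB sh sS).
  - by move=> x _; exact: sume_ge0.
  - exact: emeasurable_sum.
  - apply: muRp_ae_ge0 => x x0 _.
    have := @average_pointwise J w M (x + t) w0 w1 _ (hM _).
    have -> : \sum_(k <- J) (w k / N k)%:C%C * F (x + t + a k) =
        \sum_(k <- J) (w k / N k)%:C%C * F (x + (t + a k)).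
      by apply: eq_bigr => k _; rewrite addrA.
    move=> /(_ _)/le_trans h1.
    have -> : (\sum_(k <- J) phi k x = (\sum_(k <- J) (2 * w k * csq (dev k (x + t))
        + 2 * M%:R * (w k / N k) ^+ 2 * csq (rest a F k.+1 (x + t + a k))))%:E)%E.
      by rewrite -sumEFin; apply: eq_bigr => k _; rewrite /phi /S EFinD !EFinM addrA.
    rewrite lee_fin; apply: h1 => // k j kJ jk.
    by apply: lt_le_trans (hJ k j kJ jk) _; rewrite lerD2r lerDr.
rewrite ge0_integral_sum// -sumEFin; apply: lee_sum => k _.
rewrite /phi ge0_integralD//; first last.
- exact: measurable_funeM.
- by move=> x _; rewrite -EFinM lee_fin mulr_ge0 ?csq_ge0.
- exact: measurable_funeM.
- by move=> x _; rewrite -EFinM lee_fin mulr_ge0 ?csq_ge0.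
rewrite !ge0_integralZl ?lee_fin//; do ?by move=> x _; rewrite lee_fin csq_ge0.
rewrite EFinD (EFinM (2 * w k)) (EFinM (2 * M%:R * _)).
apply: leeD; (apply: lee_wpmul2l; first by rewrite lee_fin).
  rewrite rnorm_sqE//; apply: (ge0_shift_le (g := fun x => (csq (dev k x))%:E)).
  - by apply: emeasurable_csq; case/sq_integrableE: (dev_sq k).
  - by move=> x; rewrite lee_fin csq_ge0.
  - by move=> x x0; rewrite dev_neg// /csq/= expr0n addr0.
rewrite /energy (rnorm_sqE (hS k)); apply: (ge0_shift_le (g := fun x => (csq (S k x))%:E)).
- by apply: emeasurable_csq; case/sq_integrableE: (hS k).
- by move=> x; rewrite lee_fin csq_ge0.
- by move=> x x0; rewrite SN// /csq/= expr0n addr0.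
Qed.

(** With weights proportional to the relative energies, the rests contribute
    the inverse of a divergent sum. *)
Lemma translate_mem V t : closed_subspace V ->
  (forall s, 0 < s -> V (Sstar s (L2of F))) ->
  (forall e, 0 < e -> forall A, exists n,
    A < \sum_(k < n | rnorm (L2of h - (N k)^-1%:C%C *: L2of (piece a b F k)) < e)
          relative_energy a b F k) ->
  V (L2of (fun x => h (x + t))).
Proof.
move=> hV VS heavy; apply: csub_lim => // e e0.
have q0 := lac_q0 lac; have q1 := lac_q1 lac.
have q'0 : 0 < 1 - q by rewrite subr_gt0.
have [M qM] := q_pow_lt lac (divr_gt0 q'0 (ltr0n _ 2)).
have [K hK0] := lac_unbounded lac ((2 * c + `|t|) / (1 - q)).
have hK k : (K <= k)%N -> 2 * c + `|t| < (1 - q) * a k.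
  by move=> Kk; rewrite [ltRHS]mulrC -ltr_pdivrMr//; exact: hK0.
have c0 := lac_c_gt0 lac.
have hKc k : (K <= k)%N -> 2 * c < (1 - q) * a k.
  by move=> Kk; apply: le_lt_trans (hK k Kk); rewrite lerDl.
have hKt k : (K <= k)%N -> q * a k < t + a k.
  by move=> Kk; exact: shift_gap c0 (hK k Kk).
have e20 : 0 < e / 2 by rewrite divr_gt0.
pose re := relative_energy a b F.
have re0 k : 0 <= re k by exact: relative_energy_ge0.
(* the pieces close to [h] contribute at most [e ^+ 2 / 2]; a total relative
   energy above [A0] makes the rests contribute less than [e ^+ 2 / 2] *)
pose A0 := 4 * M%:R / e ^+ 2.
have A00 : 0 <= A0 by apply: divr_ge0; [exact: mulr_ge0|exact: sqr_ge0].
pose P k := rnorm (L2of h - (N k)^-1%:C%C *: L2of (piece a b F k)) < e / 2.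
have [n] := @sum_drop R P re re0 (heavy _ e20) K A0.
rewrite -(big_mkord (fun k => P k && (K <= k)%N) re) -big_filter.
set J := [seq k <- _ | _] => A0W.
set W := \sum_(k <- J) re k in A0W.
have W0 : 0 < W by exact: le_lt_trans A0W.
pose w k := re k / W.
have w0 k : 0 <= w k by rewrite divr_ge0// ltW.
have w1 : \sum_(k <- J) w k = 1 by rewrite -mulr_suml divff// gt_eqF.
have JP k : k \in J -> P k /\ (K <= k)%N by rewrite mem_filter => /andP[/andP[]].
have ak_pos k : (K <= k)%N -> 0 < t + a k.
  move=> Kk; apply: le_lt_trans (hKt k Kk).
  by rewrite mulr_ge0 ?(ltW q0)// (lac_a0 lac).
exists (\sum_(k <- J) (w k / N k)%:C%C *: L2of (fun x => F (x + (t + a k)))).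
  rewrite big_seq_cond; apply: csub_sum => // k; rewrite andbT => /JP[_ Kk].
  by apply: csubZ => //; rewrite -Sstar_L2of ?(ltW (ak_pos k Kk))//; exact/VS/ak_pos.
rewrite -ltr_sqr ?nnegrE ?rnorm_ge0 ?(ltW e0)//.
apply: le_lt_trans (average_rnorm w0 w1 (M := M) _ _) _.
- move=> k j /JP[_ Kk] jk; apply: le_lt_trans (hKt k Kk).
  by have [] := lac_lt lac jk.
- by move=> y; rewrite big_filter; exact: (overlap_bound lac F0 n y P qM hKc).
have E k : (w k / N k) ^+ 2 * energy a F k.+1 = w k / W.
  have en0 := energy_gt0 lac hF piece_neq0 k.+1; have Nk := N_gt0 k.
  rewrite /w /re /relative_energy -/(N k); field.
  by rewrite !gt_eqF.
apply: (@le_lt_trans _ _ (\sum_(k <- J) w k * (2 * (e / 2) ^+ 2 + 2 * M%:R / W))).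
  rewrite big_seq [leRHS]big_seq; apply: ler_sum => k /JP[Pk _].
  rewrite mulrDr; apply: lerD.
    rewrite [2 * w k]mulrC -mulrA ler_wpM2l// ler_pM2l//.
    by rewrite ler_sqr ?nnegrE ?rnorm_ge0 ?(ltW e20)// L2of_dev ltW.
  rewrite -[X in X <= _]mulrA E le_eqVlt; apply/orP; left; apply/eqP.
  by rewrite mulrCA.
rewrite -mulr_suml w1 mul1r.
exact: average_error.
Qed.

End averages.

Theorem theorem1p3 (R : realType) (a b : nat -> R) (f : L2 R) (c : R)
    (lacunary_ab : lacunary a b)
    (supp_f : L2supp f `<=` \bigcup_k `[a k, b k]%classic)
    (block_neq0 : forall k, block (a k) (b k) f != 0)
    (c_sup : c%:E = ereal_sup (range (fun k => `|b k - a k|%:E)))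
    (rel_compact : relatively_compact_in (L2_on c)
      (fun k => `|block (a k) (b k) f|^-1 *: block (a k) (b k) f)) :
  is_cyclic f.
Proof.
have [q lac] := lacunary_dataP lacunary_ab c_sup.
have mL : measurable (\bigcup_k `[a k, b k]%classic : set (measurableTypeR R)).
  by apply: bigcup_measurable => k _; exact: measurable_itv.
have [F [hF Ff FL]] := L2supp_representative mL supp_f.
have F0 x : ~ (exists k, a k <= x <= b k) -> F x = 0.
  move=> nk; apply: FL => -[k _]; rewrite /= in_itv/= => xk; apply: nk.
  by exists k.
have blockE k : block (a k) (b k) f = L2of (piece a b F k).
  by rewrite -Ff block_L2of// (lac_a0 lac).
have p0 k : L2of (piece a b F k) != 0 by rewrite -blockE.
pose N k := rnorm (L2of (piece a b F k)).
pose u k := `|block (a k) (b k) f|^-1 *: block (a k) (b k) f.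
have N0 k : 0 < N k by exact: (piece_norm_gt0 p0).
have uE k : u k = (N k)^-1%:C%C *: L2of (piece a b F k).
  by rewrite /u blockE normL2E fmorphV.
have u1 k : rnorm (u k) = 1.
  rewrite uE rnormZ /= expr0n/= addr0 sqrtr_sqr ger0_norm ?invr_ge0 ?(ltW (N0 k))//.
  by rewrite mulVf// gt_eqF.
have u_on k : L2_on c (u k).
  have hp := piece_sq lac hF k.
  rewrite uE -L2ofZ//; have hs := rpredZ (N k)^-1%:C%C hp.
  apply: (@filterS _ _ (ae_filter_ringOfSetsType (muRp R)) _ _ _ (L2of_ae hs)).
  move=> x -> cx; rewrite -[LHS]/((N k)^-1%:C%C * piece a b F k x) /piece.
  rewrite ifF ?mulr0//; apply/negP => /andP[_ xb].
  by have := lt_le_trans cx (le_trans xb (lac_c lac k)); rewrite ltxx.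
(* [h0] is the common shape of a substantial part of the pieces *)
have [h0 [_ h0c] h0heavy] := compact_heavy_point rel_compact
  (fun k => conj (subset_closure (imageT u k)) (u_on k))
  (@relative_energy_ge0 R a b F) (relative_energy_diverge lac hF F0 p0).
pose h x := if 0 <= x <= c then L2repr h0 x else 0.
have hh : h \in @sq_integrable R by exact: (window_sq c (valP (L2repr h0))).
have hh0 : L2of h = h0.
  rewrite -[RHS]L2of_repr; apply: L2of_eq => //; first exact: valP.
  have A := muRp_ae_ge0 (P := fun x : R => 0 <= x) (fun x x0 => x0).
  apply: (@filterS2 _ _ (ae_filter_ringOfSetsType (muRp R)) _ _ _ _ A h0c).
  move=> x x0 hx; rewrite /h x0/=; case: leP => // cx.
  by rewrite hx.
have h_neg x : x < 0 -> h x = 0 by rewrite /h ltNge => /negbTE ->.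
have h_c x : c < x -> h x = 0 by rewrite /h ltNge => /negbTE ->; rewrite andbF.
have heavy e : 0 < e -> forall A, exists n,
    A < \sum_(k < n | rnorm (L2of h - (N k)^-1%:C%C *: L2of (piece a b F k)) < e)
          relative_energy a b F k.
  move=> e0 A; have e0' : 0 < e%:C%C :> R[i] by rewrite ltcR.
  have [n hn] := h0heavy _ (nbhsx_ballx h0 _ e0') A; exists n.
  move: hn; rewrite (eq_bigl (fun k : 'I_n =>
    rnorm (L2of h - (N k)^-1%:C%C *: L2of (piece a b F k)) < e))//.
  move=> k; rewrite hh0 -uE; apply/asboolP/idP;
    by rewrite -ball_normE/= normL2E ltcR.
have h_neq0 : L2of h != 0.
  apply/eqP => hz; have [n] := heavy 1 ltr01 0.
  rewrite big_pred0 ?ltxx// => k.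
  by rewrite hz sub0r rnormN -uE u1 ltxx.
have VE := closed_subspace_closure_span [set Sstar t f | t in [set t : R | 0 < t]].
rewrite /is_cyclic /cyclic_subspace.
apply: (translates_total VE hh h_neg h_c h_neq0) => t.
apply: (translate_mem lac hF F0 p0 hh h_neg _ VE) => // s s0.
apply: subset_closure; apply: linear_span_sub; rewrite Ff.
by exists s.
Qed.
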